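(* (Upper bound) There is an absolute constant $C>0$ such that for all integers $k\geq 1$ and $r\geq 2$ and every graph $G$ of simple treewidth at most $k$, $$\mathrm{wcol}_r(G)\leq C\, r^{k-1}\log r.$$ (Lower bound) For all integers $k\geq 1$ and $r\geq 1$ there is a graph $G$ of simple treewidth at most $k$ such that $$\mathrm{wcol}_r(G)\geq \frac{r^{k-1}\ln r}{k!}.$$
   Context: All graphs are finite, simple, and undirected. $\log$ is the logarithm in base $2$ and $\ln$ is the natural logarithm. The length of a path is its number of edges. Weak coloring numbers: let $G$ be a graph, let $\sigma$ be an ordering (linear order) of $V(G)$, and let $r\geq 0$ be an integer. For vertices $u,v$ of $G$, $u$ is weakly $r$-reachable from $v$ in $\sigma$ if there exists a path in $G$ with ends $u$ and $v$ of length at most $r$ such that $u\leq_\sigma w$ for every vertex $w$ on the path (in particular $v$ is weakly $r$-reachable from itself). Let $\mathrm{WReach}_r[G,\sigma,v]$ be the set of vertices weakly $r$-reachable from $v$ in $\sigma$. Define $\mathrm{wcol}_r(G,\sigma)=\max_{v\in V(G)}|\mathrm{WReach}_r[G,\sigma,v]|$ and $\mathrm{wcol}_r(G)=\min_\sigma \mathrm{wcol}_r(G,\sigma)$, where $\sigma$ ranges over all orderings of $V(G)$. Simple treewidth: a simple $k$-tree is any graph that can be obtained by starting with a $(k+1)$-clique and repeatedly choosing an existing $k$-clique and adding a new vertex adjacent to all vertices of that clique, with the requirement that the same $k$-clique is never chosen more than once. The simple treewidth $\mathrm{stw}(G)$ of a graph $G$ is the smallest nonnegative integer $k$ such that $G$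 is a subgraph of a simple $k$-tree. *)

(* Defs.v *)
From HB Require Import structures.
From mathcomp Require Import all_boot all_order all_algebra.
From mathcomp Require Import boolp reals exp.

Set Implicit Arguments.
Unset Strict Implicit.
Unset Printing Implicit Defensive.

Import Order.TTheory GRing.Theory Num.Theory.

Record graph := Graph {
  vertex :> finType;
  adj : rel vertex;
  adj_sym : symmetric adj;
  adj_irrefl : irreflexive adj
}.
Arguments adj : clear implicits.

Definition subgraph (G H : graph) : Prop :=
  exists f : G -> H, injective f /\ forall x y, adj G x y -> adj H (f x) (f y).

Definition min_nat (P : nat -> Prop) (exP : exists n, P n) : nat :=
  @ex_minn (fun n => `[< P n >])
    (let: ex_intro n Pn := exP in ex_intro _ n (asboolT Pn)).

Lemma min_natP (P : nat -> Prop) (exP : exists n, P n) :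
  P (min_nat exP) /\ forall n, P n -> (min_nat exP <= n)%N.
Proof.
rewrite /min_nat; case: ex_minnP => m /asboolP Pm le_m.
by split=> // n Pn; apply/le_m/asboolP.
Qed.

Definition linear_order (T : Type) (le : rel T) : Prop :=
  [/\ reflexive le, antisymmetric le, transitive le & total le].

Lemma linear_order_exists (T : finType) : exists le : rel T, linear_order le.
Proof.
exists (fun x y => enum_rank x <= enum_rank y)%N; split.
- by move=> x; apply: leqnn.
- move=> x y; rewrite -eqn_leq => /eqP exy.
  by apply: enum_rank_inj; apply: val_inj.
- by move=> y x z; apply: leq_trans.
- by move=> x y; apply: leq_total.
Qed.

Section WeakColoring.

Variables (r : nat) (G : graph).

(* The path has vertex sequence v :: p, hence size p edges. *)
Definition weakly_reachable (le : rel G) (v u : G) : Prop :=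
  exists p : seq G,
    [/\ path (adj G) v p, uniq (v :: p), last v p = u, (size p <= r)%N
      & forall w, w \in v :: p -> le u w].

Definition WReach (le : rel G) (v : G) : {set G} :=
  [set u | `[< weakly_reachable le v u >]].

(* For the graph with no vertex this maximum is 0. *)
Definition wcol_order (le : rel G) : nat := \max_(v : G) #|WReach le v|.

Lemma wcol_subproof :
  exists m, exists2 le : rel G, linear_order le & wcol_order le = m.
Proof.
by have [le le_lin] := linear_order_exists G; exists (wcol_order le), le.
Qed.

Definition wcol : nat := min_nat wcol_subproof.

End WeakColoring.

Definition clique (G : graph) (A : {set G}) : Prop :=
  {in A &, forall x y, x != y -> adj G x y}.

(* The successive graphs of a construction sequence are represented as induced
   subgraphs of one graph G: simple_ktree_seq k A U means that G[A] is obtained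
   by some sequence of steps whose chosen k-cliques form the set U.  The new
   vertex v is adjacent within G[v |: A] to exactly the vertices of Q. *)
Inductive simple_ktree_seq (k : nat) (G : graph) :
    {set G} -> {set {set G}} -> Prop :=
| SimpleKtreeStart (A : {set G}) :
    clique A -> #|A| = k.+1 -> simple_ktree_seq k A set0
| SimpleKtreeStep (A : {set G}) (U : {set {set G}}) (Q : {set G}) (v : G) :
    simple_ktree_seq k A U ->
    Q \subset A -> clique Q -> #|Q| = k -> Q \notin U ->
    v \notin A -> (forall x, x \in A -> adj G v x = (x \in Q)) ->
    simple_ktree_seq k (v |: A) (Q |: U).

Definition simple_ktree (k : nat) (G : graph) : Prop :=
  exists U, simple_ktree_seq k [set: G] U.

Section SimpleTreewidth.

Variable G : graph.

Lemma stw_subproof : exists k, exists2 H, simple_ktree k H & subgraph G H.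
Proof.
pose e : rel 'I_#|G|.+1 := fun x y => x != y.
have e_sym : symmetric e by move=> x y; rewrite /e eq_sym.
have e_irr : irreflexive e by move=> x; rewrite /e eqxx.
exists #|G|, (Graph e_sym e_irr).
  exists set0; apply: SimpleKtreeStart; first by [].
  by rewrite cardsT card_ord.
exists (fun x => widen_ord (leqnSn _) (enum_rank x)); split.
  by move=> x y [] exy; apply/enum_rank_inj/val_inj.
move=> x y /= xy; apply/eqP => -[] exy.
have {}exy : x = y by apply/enum_rank_inj/val_inj.
by move: xy; rewrite exy adj_irrefl.
Qed.

Definition stw : nat := min_nat stw_subproof.

End SimpleTreewidth.

Definition log2 (R : realType) (x : R) : R := (ln x / ln 2)%R.

(* Main.v *)
Require Import Defs.
From mathcomp Require Import all_boot all_order all_algebra.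
From mathcomp Require Import zify lra.
From mathcomp Require Import boolp reals exp.

(** Both bounds count, for a well chosen order, the vertices that weak
    reachability can collect one breadth-first layer at a time.

    Upper bound.  A simple k-tree, with its vertices ranked by their date of
    creation, has three properties: the earlier neighbours of a vertex form a
    clique, cliques have at most k+1 vertices, and k-cliques have at most two
    common neighbours (simple_ktree_thin).  They pass to induced subgraphs,
    and the breadth-first layers satisfy them with k-1 in place of k: a clique
    inside a layer has a common neighbour in the previous layer (thin_level).
    So one can order the layers increasingly, each layer inductively.  A walk
    from a clique K to a vertex u of layer i that stays above u in this order
    stays in the layers from i on; it enters layer i in a clique, the shadow
    of K, and its later excursions to higher layers can be cut short, since
    they leave and return through adjacent vertices (excursion).  Hence what K
    reaches in layer i is reached, inside that layer, from the shadow of K,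
    with a budget diminished by the distance (reach_level).  Summing over the
    layers gives, for the numbers g_n(s) of vertices reached from a clique
    within distance s in the class k = n+1,
      g_(n+1)(s) <= g_n(s) + g_n(0) + g_n(1) + ... + g_n(s).
    For k = 1 the graph is a union of paths; ordering a path by decreasing
    2-adic valuation of positions gives O(log s) reachable vertices
    (ruler_reach).  Solving the recursion with a constant that does not depend
    on k takes some care: the bound 4 L (s+1)^n - L (n+3), with L of order
    log r, is stable under the recursion for 1 <= s < r, and the single-vertex
    bound for budget r, whose sum stops at s = r-1, then becomes 4 L r^n
    (good_order_step).

    Lower bound.  The extremal graphs are truncations of the universal simple
    k-tree, in which every k-clique that is created is used once.  Its vertices
    are words over k letters (slot, stw_word_graph), and the descendants of
    u i that avoid the letter i are all adjacent to u and form a copy of the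
    universal simple (k-1)-tree.  Given an order, take v from which m1 vertices
    are weakly reachable within distance r, and many disjoint copies of the
    (k-1)-dimensional graph attached to v.  Either each copy has a vertex
    below v, so v itself reaches many vertices in one step, or some copy lies
    above v, and the m2 vertices reachable within distance r+1 inside it are
    joined, through v, by the m1 old ones (forces_step).  Paths start the
    induction: from some vertex of a path with 2^m vertices one reaches more
    than m vertices (segment_reach).  The resulting recursion
    f_(k+1)(r+1) = f_(k+1)(r) + f_k(r+1) dominates r^(k-1) ln r / k!
    (ln_recursion). *)

Set Implicit Arguments.
Unset Strict Implicit.
Unset Printing Implicit Defensive.

Import Order.TTheory GRing.Theory Num.Theory.
Local Open Scope nat_scope.

(** * Weak reachability along walks *)

(** Weak reachability inside the subgraph induced by [A].  Walks replace
    paths because the arguments below cut and concatenate them; in the whole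
    graph the two notions agree. *)
Definition walk_reach (G : graph) (A : {set G}) (le : rel G) (s : nat)
    (v u : G) : Prop :=
  exists p, [/\ path (adj G) v p, {subset v :: p <= A}, last v p = u,
    size p <= s & forall w, w \in v :: p -> le u w].

Lemma weakly_reachableP (r : nat) (G : graph) (le : rel G) (v u : G) :
  weakly_reachable r le v u <-> walk_reach [set: G] le r v u.
Proof.
split=> [[p [pP _ pu pr ple]]|[p [pP _ <- pr ple]]].
  by exists p; split=> // x _; rewrite in_setT.
case/shortenP: pP ple => p' p'P p'U sub_p' ple.
exists p'; split=> //.
  apply: leq_trans pr; apply: uniq_leq_size; last exact: sub_p'.
  by case/andP: p'U.
move=> w; rewrite inE => /orP[/eqP->|/sub_p' wp]; apply: ple.
  by rewrite mem_head.
by rewrite inE wp orbT.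
Qed.

(** Sources are sets because the induction on layers starts from one
    vertex but meets whole cliques in the lower layers. *)
Definition reach_set (G : graph) (A : {set G}) (le : rel G) (s : nat)
    (K : {set G}) : {set G} :=
  [set u | `[< exists2 c, c \in K & walk_reach A le s c u >]].

Lemma reach_setP (G : graph) (A : {set G}) (le : rel G) s (K : {set G}) u :
  reflect (exists2 c, c \in K & walk_reach A le s c u)
          (u \in reach_set A le s K).
Proof. by rewrite inE; apply: asboolP. Qed.

Lemma WReachE (r : nat) (G : graph) (le : rel G) (v : G) :
  WReach r le v = reach_set [set: G] le r [set v].
Proof.
apply/setP=> u; rewrite inE; apply/asboolP/reach_setP.
  by move/weakly_reachableP; exists v; rewrite ?inE.
by case=> c /set1P-> /weakly_reachableP.
Qed.

Lemma reach_set_sub (G : graph) (A : {set G}) (le : rel G) s (K : {set G}) :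
  reach_set A le s K \subset A.
Proof.
apply/subsetP=> u /reach_setP[c _ [p [_ pA <- _ _]]].
by apply: pA; rewrite mem_last.
Qed.

Lemma reach_set0 (G : graph) (A : {set G}) (le : rel G) (K : {set G}) :
  reach_set A le 0 K \subset K.
Proof. by apply/subsetP=> u /reach_setP[c cK [[|x p] [_ _ <- //]]]. Qed.

Lemma reach_setS (G : graph) (A : {set G}) (le : rel G) s (K K' : {set G}) :
  K \subset K' -> reach_set A le s K \subset reach_set A le s K'.
Proof.
move=> /subsetP KK; apply/subsetP=> u /reach_setP[c /KK cK cu].
by apply/reach_setP; exists c.
Qed.

Lemma reach_set1P (G : graph) (A : {set G}) (le : rel G) s v u :
  reflect (walk_reach A le s v u) (u \in reach_set A le s [set v]).
Proof.
by apply: (iffP (reach_setP _ _ _ _ _)) => [[c /set1P->]|vu] //; exists v; rewrite ?set11.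
Qed.

Lemma walk_reach_mono (G : graph) (A B : {set G}) (le : rel G) s t v u :
  A \subset B -> s <= t -> walk_reach A le s v u -> walk_reach B le t v u.
Proof.
move=> /subsetP AB st [p [vP pA lp sp pmin]]; exists p; split=> //.
  by move=> z /pA/AB.
exact: leq_trans sp st.
Qed.

Lemma reach_set_mono (G : graph) (A B : {set G}) (le : rel G) s t (K : {set G}) :
  A \subset B -> s <= t -> reach_set A le s K \subset reach_set B le t K.
Proof.
move=> AB st; apply/subsetP=> u /reach_setP[c cK cu]; apply/reach_setP.
by exists c => //; apply: walk_reach_mono cu.
Qed.

Lemma card_reach_set (G : graph) (A : {set G}) (le : rel G) s (K : {set G}) M :
  (forall v, v \in K -> #|reach_set A le s [set v]| <= M) ->
  #|reach_set A le s K| <= #|K| * M.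
Proof.
move=> KM; have -> : reach_set A le s K = \bigcup_(v in K) reach_set A le s [set v].
  apply/setP=> u; apply/reach_setP/bigcupP.
    by case=> c cK cu; exists c => //; apply/reach_setP; exists c; rewrite ?set11.
  by case=> c cK /reach_setP[c' /set1P-> cu]; exists c.
apply: (@leq_trans (\sum_(v in K) #|reach_set A le s [set v]|)).
  elim/big_rec2: _ => [|v a B _ Ba]; first by rewrite cards0.
  by apply: leq_trans (leq_card_setU _ _) _; rewrite leq_add2l.
by rewrite -sum_nat_const; apply: leq_sum.
Qed.

Lemma wcol_le r (G : graph) (le : rel G) m :
  linear_order le -> (forall v, #|WReach r le v| <= m) -> wcol r G <= m.
Proof.
move=> lin lem; have [_ minP] := min_natP (wcol_subproof r G).
apply: leq_trans (_ : wcol_order r le <= m); first by apply: minP; exists le.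
by apply/bigmax_leqP.
Qed.

Lemma wcolP r (G : graph) :
  exists2 le : rel G, linear_order le & forall v, #|WReach r le v| <= wcol r G.
Proof.
have [[le lin leE] _] := min_natP (wcol_subproof r G).
by exists le => // v; rewrite /wcol -leE; apply: leq_bigmax.
Qed.

Lemma wcol_subgraph r (G H : graph) : subgraph G H -> wcol r G <= wcol r H.
Proof.
case=> f [f_inj f_adj]; have [le [refl anti trans tot] leP] := wcolP r H.
apply: (@wcol_le _ _ (fun x y => le (f x) (f y))).
  split=> [x|x y|y x z|x y]; [exact: refl| |exact: trans|exact: tot].
  by move/anti/f_inj.
move=> v; apply: leq_trans (leP (f v)); rewrite -(card_imset _ f_inj).
apply: subset_leq_card; apply/subsetP=> _ /imsetP[u + ->].
rewrite !inE => /asboolP[p [pP pU lp sp pmin]]; apply/asboolP; exists (map f p).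
split; rewrite ?last_map ?lp ?size_map //.
- rewrite path_map; apply: sub_path pP => x y; exact: f_adj.
- by rewrite -map_cons (map_inj_uniq f_inj).
- by move=> w; rewrite -map_cons => /mapP[w' wp ->]; apply: pmin.
Qed.

(** * Elimination ranks and thin vertex sets *)

(** The reverse of a perfect elimination order: [rho] dates the vertices,
    and the neighbours older than a given vertex are pairwise adjacent. *)
Definition elimination_rank (G : graph) (rho : G -> nat) : Prop :=
  injective rho /\
  forall x y z, adj G x z -> adj G y z -> rho x < rho z -> rho y < rho z ->
    x != y -> adj G x y.

(** The properties of a simple [k]-tree on which the upper bound rests.
    Unlike being a simple [k]-tree, they are hereditary and can be checked
    in a breadth-first layer. *)
Definition thin (G : graph) (k : nat) (A : {set G}) : Prop :=
  (forall Q : {set G}, Q \subset A -> clique Q -> #|Q| <= k.+1) /\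
  (forall Q : {set G}, Q \subset A -> clique Q -> #|Q| = k ->
     #|[set x in A | [forall q in Q, adj G q x]]| <= 2).

Lemma cliqueU1 (G : graph) (Q : {set G}) x :
  clique Q -> (forall q, q \in Q -> adj G q x) -> clique (x |: Q).
Proof.
move=> cQ Qx y z /setU1P[->|yQ] /setU1P[->|zQ] yz.
- by rewrite eqxx in yz.
- by rewrite adj_sym; apply: Qx.
- exact: Qx.
- exact: cQ.
Qed.

Lemma common_notin (G : graph) (Q : {set G}) x :
  (forall q, q \in Q -> adj G q x) -> x \notin Q.
Proof. by move=> Qx; apply/negP=> /Qx; rewrite adj_irrefl. Qed.

Lemma thinS (G : graph) k (A : {set G}) : thin k A -> thin k.+1 A.
Proof.
move=> [small few]; split=> [Q QA cQ|Q QA cQ Qk].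
  exact: leqW (small Q QA cQ).
rewrite leqNgt; apply/negP=> /ltnW /ltnW /card_gt0P[x].
rewrite inE => /andP[xA /forall_inP Qx].
have: #|x |: Q| <= k.+1.
  apply: small; last exact: cliqueU1.
  by rewrite subUset sub1set xA.
by rewrite cardsU1 (common_notin Qx) Qk add1n ltnn.
Qed.

Lemma thin_leq (G : graph) k l (A : {set G}) : k <= l -> thin k A -> thin l A.
Proof.
move=> /subnK <-; elim: (l - k) => [//|n IHn] /IHn; exact: thinS.
Qed.

Lemma thin_sub (G : graph) k (A B : {set G}) : B \subset A -> thin k A -> thin k B.
Proof.
move=> BA [small few]; split=> [Q QB|Q QB cQ Qk].
  exact: small (subset_trans QB BA).
apply: leq_trans (few Q (subset_trans QB BA) cQ Qk).
apply: subset_leq_card; apply/subsetP=> x; rewrite !inE => /andP[xB ->].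
by rewrite (subsetP BA).
Qed.

(** The bound on common neighbours has to remember the used cliques for the
    induction to go through: a [k]-clique gets its first common neighbour when
    it is created (or from the initial clique), and a second one only when it
    is chosen, which marks it as used. *)
Lemma simple_ktree_seq_thin k (G : graph) (A : {set G}) (U : {set {set G}}) :
  simple_ktree_seq k A U ->
  exists rho : G -> nat,
  [/\ forall x, x \in A -> rho x < #|A|,
      {in A &, injective rho},
      forall x y z, x \in A -> y \in A -> z \in A -> adj G x z -> adj G y z ->
        rho x < rho z -> rho y < rho z -> x != y -> adj G x y,
      forall Q : {set G}, Q \subset A -> clique Q -> #|Q| <= k.+1
    & forall Q : {set G}, Q \subset A -> clique Q -> #|Q| = k ->
        #|[set x in A | [forall q in Q, adj G q x]]| <= 1 + (Q \in U)].
Proof.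
elim=> [{U}A cA Ak|{}A {}U Q v _ [rho [lt inj peo small few]] QA cQ Qk QU vA vQ].
  exists (fun x => index x (enum A)); split.
  - by move=> x xA; rewrite cardE index_mem mem_enum.
  - move=> x y xA yA /= exy; have xe : x \in enum A by rewrite mem_enum.
    by rewrite -(nth_index x xe) exy nth_index // mem_enum.
  - by move=> x y z xA yA _ _ _ _ _; apply: cA.
  - by move=> Q QA _; rewrite -Ak; apply: subset_leq_card.
  - move=> Q QA _ Qk; rewrite in_set0 addn0.
    have <- : #|A :\: Q| = 1 by rewrite cardsDS // Ak Qk subSn ?subnn.
    apply: subset_leq_card; apply/subsetP=> x; rewrite !inE => /andP[-> /forall_inP Qx].
    by rewrite (common_notin Qx).
have avQ x : x \in A -> adj G x v = (x \in Q) by move=> xA; rewrite adj_sym vQ.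
have nv x : x \in A -> x != v by apply: contraTneq => ->.
have inU (P : {set G}) : P \subset v |: A -> P :\ v \subset A.
  by move=> PA; rewrite subDset.
have PvQ (P : {set G}) : P \subset v |: A -> clique P -> v \in P -> P :\ v \subset Q.
  move=> PA cP vP; apply/subsetP=> x xP; have xA := subsetP (inU P PA) _ xP.
  rewrite -vQ //; move: xP; rewrite !inE => /andP[xv xP].
  by apply: cP; rewrite // eq_sym.
have subA (P : {set G}) : P \subset v |: A -> v \notin P -> P \subset A.
  by move=> PA vP; have := inU P PA; rewrite (setDidPl _) // disjoint_sym disjoints1.
exists (fun x => if x == v then #|A| else rho x); split.
- move=> x; rewrite cardsU1 vA add1n => /setU1P[->|xA]; first by rewrite eqxx.
  by rewrite (negPf (nv _ xA)) ltnS ltnW ?lt.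
- move=> x y /setU1P[->|xA] /setU1P[->|yA] //; rewrite ?eqxx ?(negPf (nv _ _)) //.
  + by move=> e; have := lt y yA; rewrite -e ltnn.
  + by move=> e; have := lt x xA; rewrite e ltnn.
  + exact: inj.
- have nvz x z : x \in v |: A -> (if x == v then #|A| else rho x) < rho z ->
      z \in A -> x \in A.
    by case/setU1P=> [->|//]; rewrite eqxx => zA zA'; have := lt z zA'; lia.
  move=> x y z xA yA /setU1P[->|zA] xz yz; last first.
    rewrite (negPf (nv _ zA)) => xlt ylt; move: (xlt) (ylt).
    have {}xA := nvz x z xA xlt zA; have {}yA := nvz y z yA ylt zA.
    by rewrite !(negPf (nv _ _)) //; apply: peo.
  have inA w : w \in v |: A -> adj G w v -> w \in A.
    by case/setU1P=> [->|//]; rewrite adj_irrefl.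
  have {}xA := inA x xA xz; have {}yA := inA y yA yz.
  by move=> _ _; apply: cQ; rewrite -avQ.
- move=> P PA cP; have [vP|vP] := boolP (v \in P); last exact: small (subA _ PA vP) cP.
  by rewrite (cardsD1 v) vP add1n ltnS -Qk; apply: subset_leq_card; apply: PvQ.
move=> P PA cP Pk; have [vP|vP] := boolP (v \in P).
  rewrite (@leq_trans 1) // -(leq_add2r #|P :\ v|) add1n.
  have -> : #|P :\ v|.+1 = #|Q| by rewrite Qk -Pk (cardsD1 v P) vP.
  set X := [set x in _ | _].
  have <- : #|X :|: (P :\ v)| = #|X| + #|P :\ v|.
    rewrite cardsU (_ : X :&: _ = set0) ?cards0 ?subn0 //.
    apply/setP=> x; rewrite in_set0 !inE; apply/negP => /andP[/andP[_ /forall_inP Px]].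
    by rewrite (negPf (common_notin Px)) andbF.
  apply: subset_leq_card; rewrite subUset PvQ // andbT; apply/subsetP=> x.
  rewrite inE => /andP[/setU1P[->|xA] /forall_inP/(_ v vP)]; last by rewrite vQ.
  by rewrite adj_irrefl.
have PA' := subA _ PA vP; have := few P PA' cP Pk.
have [->|PQ] := eqVneq P Q => Pfew.
  rewrite setU11; rewrite (negPf QU) addn0 in Pfew.
  apply: leq_trans (_ : #|v |: [set x in A | [forall q in Q, adj G q x]]| <= _).
    apply: subset_leq_card; apply/subsetP=> x; rewrite !inE.
    by case/andP=> /orP[->//|->->]; rewrite orbT.
  rewrite cardsU1; exact: leq_add (leq_b1 _) Pfew.
rewrite !inE (negPf PQ) /=; apply: leq_trans Pfew; apply: subset_leq_card.
apply/subsetP=> x; rewrite !inE => /andP[/orP[/eqP->|->->//] /forall_inP Pv].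
case/eqP: PQ; apply/eqP; rewrite eqEcard Pk Qk leqnn andbT; apply/subsetP=> q qP.
by rewrite -avQ ?(subsetP PA') // Pv.
Qed.

Lemma simple_ktree_thin k (G : graph) : simple_ktree k G ->
  exists2 rho : G -> nat, elimination_rank rho & thin k [set: G].
Proof.
case=> U /simple_ktree_seq_thin[rho [_ inj peo small few]]; exists rho.
  by split=> [x y|x y z]; [apply: inj|apply: peo]; rewrite ?in_setT.
split=> // Q QT cQ Qk; apply: leq_trans (few Q QT cQ Qk) _.
by rewrite -[2]/(1 + 1) leq_add2l leq_b1.
Qed.

(** * Breadth-first layers *)

(** The edges between layers go from a vertex back to an older one, so that
    [d] behaves like the distance to the oldest vertex of each connected
    component. *)
Definition layering (G : graph) (rho : G -> nat) (A : {set G}) (d : G -> nat) :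
    Prop :=
  (forall x y, x \in A -> y \in A -> adj G x y -> rho y < rho x ->
     d y <= d x /\ 0 < d x <= (d y).+1) /\
  (forall x, x \in A -> 0 < d x ->
     exists y, [/\ y \in A, adj G x y, rho y < rho x & d x = (d y).+1]).

(** The youngest vertex is put one layer after its lowest neighbour; the
    other neighbours are adjacent to that one, so none of them is more than
    one layer higher. *)
Lemma layering_exists (G : graph) (rho : G -> nat) (A : {set G}) :
  elimination_rank rho -> exists d, layering rho A d.
Proof.
move=> [rho_inj peo].
elim: {A}#|A| {-2}A (erefl #|A|) => [|n IHn] A An.
  exists (fun=> 0); split=> [x y|x //].
  by rewrite (cards0_eq An) inE.
have /card_gt0P[x0 x0A] : 0 < #|A| by rewrite An.
pose v := [arg max_(x > x0 in A) rho x].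
have [vA vmax] : v \in A /\ forall x, x \in A -> rho x <= rho v.
  by rewrite /v; case: arg_maxnP.
have vlt x : x \in A -> x != v -> rho x < rho v.
  move=> xA xv; rewrite ltn_neqAle vmax // andbT.
  by apply: contra_neq xv => /rho_inj.
case: (IHn (A :\ v)) => [|d [d1 d2]].
  by move: (cardsD1 v A); rewrite vA An => -[].
have [/existsP[y0 /andP[y0A y0v]]|/existsPn no_nbr] :=
    boolP [exists y, (y \in A) && adj G v y]; last first.
  exists (fun x => if x == v then 0 else d x); split=> [x y xA yA xy yx|x xA].
    have xv : x != v.
      by apply: contraTneq xy => ->; have := no_nbr y; rewrite yA.
    have yv : y != v.
      apply: contraTneq xy => ->; have := no_nbr x.
      by rewrite xA adj_sym.
    by rewrite (negPf xv) (negPf yv); apply: d1; rewrite ?inE ?xv ?yv.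
  case: eqP => // /eqP xv dx; have [|y [yA xy yx dxy]] := d2 x _ dx.
    by rewrite !inE xv xA.
  move: yA; rewrite !inE => /andP[yv yA].
  by exists y; rewrite (negPf yv).
pose m := [arg min_(y < y0 | (y \in A) && adj G v y) d y].
have [mA vm mmin] : [/\ m \in A, adj G v m &
     forall y, y \in A -> adj G v y -> d m <= d y].
  rewrite /m; case: arg_minnP; first by rewrite y0A.
  by move=> i /andP[iA vi] imin; split=> // y yA vy; apply: imin; rewrite yA.
clearbody m.
have nv y : adj G v y -> y != v.
  by apply: contraTneq => ->; rewrite adj_irrefl.
have mv := nv _ vm.
exists (fun x => if x == v then (d m).+1 else d x); split.
  move=> x y xA yA xy yx; have [xv|xv] := eqVneq x v; last first.
    have yv : y != v.
      by apply: contraTneq yx => ->; rewrite -leqNgt vmax.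
    by rewrite (negPf yv); apply: d1; rewrite ?inE ?xv ?yv.
  move: xy yx; rewrite {}xv => vy yx; rewrite (negPf (nv _ vy)).
  have dmy := mmin _ yA vy; split; last by rewrite ltnS.
  have [->|my] := eqVneq m y; first exact: leqnSn.
  have amy : adj G m y.
    by apply: (peo m y v); rewrite // 1?adj_sym // vlt // nv.
  have [ym|ym|/rho_inj e] := ltngtP (rho m) (rho y); last by rewrite e eqxx in my.
    have [] := d1 y m _ _ _ ym; rewrite ?inE ?mA ?yA ?mv ?(nv _ vy) //.
      by rewrite adj_sym.
    by move=> _ /andP[].
  have [] := d1 m y _ _ amy ym; rewrite ?inE ?mA ?yA ?mv ?(nv _ vy) //.
  by move=> /leqW.
move=> x xA; case: (eqVneq x v) => [->|xv] dx.
  by exists m; rewrite (negPf mv) vlt.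
have [|y [yA xy yx dxy]] := d2 x _ dx; first by rewrite !inE xv xA.
move: yA; rewrite !inE => /andP[yv yA].
by exists y; rewrite (negPf yv).
Qed.

Definition level (G : graph) (A : {set G}) (d : G -> nat) (i : nat) : {set G} :=
  [set x in A | d x == i].

Lemma levelP (G : graph) (A : {set G}) (d : G -> nat) i x :
  reflect (x \in A /\ d x = i) (x \in level A d i).
Proof. by rewrite inE; apply: (iffP andP) => -[xA /eqP]. Qed.

Lemma level_sub (G : graph) (A : {set G}) (d : G -> nat) i :
  level A d i \subset A.
Proof. by apply/subsetP=> x /levelP[]. Qed.

Lemma layering_lt (G : graph) (rho : G -> nat) (A : {set G}) (d : G -> nat) x y :
  elimination_rank rho -> layering rho A d ->
  x \in A -> y \in A -> adj G x y -> d y < d x -> rho y < rho x.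
Proof.
move=> [rho_inj _] [d1 _] xA yA xy.
case: (ltngtP (rho y) (rho x)) => // [yx|/rho_inj->]; last by rewrite ltnn.
by have [] := d1 y x yA xA _ yx; rewrite 1?adj_sym // leqNgt => /negP.
Qed.

Lemma layering_step (G : graph) (rho : G -> nat) (A : {set G}) (d : G -> nat) x y :
  elimination_rank rho -> layering rho A d ->
  x \in A -> y \in A -> adj G x y -> d x <= (d y).+1.
Proof.
move=> [rho_inj _] [d1 _] xA yA xy.
case: (ltngtP (rho y) (rho x)) => [yx|yx|/rho_inj e].
- by have [_ /andP[]] := d1 x y xA yA xy yx.
- by rewrite adj_sym in xy; have [/leqW] := d1 y x yA xA xy yx.
- by move: xy; rewrite e adj_irrefl.
Qed.

(** The youngest vertex [m] of the clique has a parent one layer below, and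
    this parent is adjacent to the other vertices of the clique because they
    are all older neighbours of [m]. *)
Lemma common_parent (G : graph) (rho : G -> nat) (A : {set G}) (d : G -> nat) i
    (Q : {set G}) q0 :
  elimination_rank rho -> layering rho A d ->
  Q \subset level A d i -> clique Q -> q0 \in Q -> 0 < i ->
  exists2 x, x \in A & (d x).+1 = i /\ forall q, q \in Q -> adj G q x.
Proof.
move=> er lay /subsetP QL cQ q0Q i_gt0.
pose m := [arg max_(x > q0 in Q) rho x].
have [mQ mmax] : m \in Q /\ forall x, x \in Q -> rho x <= rho m.
  by rewrite /m; case: arg_maxnP.
clearbody m; have /levelP[mA dm] := QL _ mQ.
have [|x [xA mx xm dx]] := lay.2 m mA; first by rewrite dm.
have dxi : (d x).+1 = i by rewrite -dx.
exists x => //; split=> // q qQ; have [->//|qm] := eqVneq q m.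
have /levelP[qA dq] := QL _ qQ.
apply: (er.2 _ _ m); rewrite 1?adj_sym //.
- by apply: cQ; rewrite // eq_sym.
- by rewrite ltn_neqAle mmax // andbT; apply: contra_neq qm => /er.1.
- by apply/eqP=> e; move: dxi; rewrite -e dq => /esym/n_Sn.
Qed.

(** Adding a common parent to a clique of the layer bounds the size of
    cliques.  For common neighbours [z1], [z2], [z3] in the layer, the three
    cliques obtained by adding [zj] have parents [xj]; these are equal or
    adjacent, and any coincidence pattern produces a (k+1)-clique of [A] with
    three common neighbours among the [zj] and [xj]. *)
Lemma thin_level (G : graph) (rho : G -> nat) (A : {set G}) (d : G -> nat) i k :
  elimination_rank rho -> layering rho A d -> 0 < k ->
  thin k.+1 A -> thin k (level A d i).
Proof.
move=> er lay k_gt0 [small few].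
case: (posnP i) => [->|i_gt0].
  have edge0 x y : x \in level A d 0 -> y \in level A d 0 -> adj G x y -> False.
    move=> /levelP[xA dx] /levelP[yA dy] xy.
    case: (ltngtP (rho y) (rho x)) => [yx|yx|/er.1 e].
    - by have [_] := lay.1 x y xA yA xy yx; rewrite dx ltnn.
    - by rewrite adj_sym in xy; have [_] := lay.1 y x yA xA xy yx; rewrite dy ltnn.
    - by move: xy; rewrite e adj_irrefl.
  split=> [Q /subsetP QL cQ|Q /subsetP QL cQ Qk].
    rewrite (@leq_trans 1) //; apply/card_le1P=> x xQ y; rewrite !inE.
    apply/idP/eqP => [yQ|->//]; apply: contrapT => /eqP yx.
    by apply: (edge0 y x); [apply: QL|apply: QL|apply: cQ].
  have /card_gt0P[q qQ] : 0 < #|Q| by rewrite Qk.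
  rewrite (@leq_trans 0) // leqn0 cards_eq0; apply/eqP/setP=> x.
  rewrite in_set0 inE; apply/negP=> /andP[xL /forall_inP/(_ _ qQ)].
  exact: edge0 (QL _ qQ) xL.
have sub := subset_trans _ (level_sub A d i).
have Qx_clique (Q : {set G}) x : Q \subset level A d i -> clique Q -> x \in A ->
    (forall q, q \in Q -> adj G q x) ->
    [/\ x |: Q \subset A, clique (x |: Q) & #|x |: Q| = #|Q|.+1].
  move=> QL cQ xA Qx; rewrite cardsU1 (common_notin Qx) add1n.
  by split; [rewrite subUset sub1set xA sub|exact: cliqueU1|].
split=> [Q QL cQ|Q QL cQ Qk].
  have [->|[q0 q0Q]] := set_0Vmem Q; first by rewrite cards0.
  have [x xA [_ Qx]] := common_parent er lay QL cQ q0Q i_gt0.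
  have [QA cxQ Qk] := Qx_clique Q x QL cQ xA Qx.
  by rewrite -ltnS -Qk; apply: small.
have /card_gt0P[q0 q0Q] : 0 < #|Q| by rewrite Qk.
rewrite leqNgt; apply/negP=> /card_gt2P[z1 [z2 [z3 [[Z1 Z2 Z3] [n12 n23 n31]]]]].
have parent z : z \in [set x in level A d i | [forall q in Q, adj G q x]] ->
    [/\ z \in A, d z = i & forall q, q \in Q -> adj G q z] /\
    exists2 x, [/\ x \in A, (d x).+1 = i & adj G z x] &
      forall q, q \in Q -> adj G q x.
  rewrite inE => /andP[zL /forall_inP Qz]; have /levelP[zA dz] := zL.
  split=> //; have [||||x xA [dx Qx]] := @common_parent _ _ _ _ i (z |: Q) z er lay.
  - by rewrite subUset sub1set zL.
  - exact: cliqueU1.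
  - exact: setU11.
  - by [].
  exists x; first by split=> //; apply: Qx; apply: setU11.
  by move=> q qQ; apply: Qx; rewrite setU1r.
have [[zA1 dz1 Qz1] [x1 [xA1 dx1 zx1] Qx1]] := parent _ Z1.
have [[zA2 dz2 Qz2] [x2 [xA2 dx2 zx2] Qx2]] := parent _ Z2.
have [[zA3 dz3 Qz3] [x3 [xA3 dx3 zx3] Qx3]] := parent _ Z3.
(* applied with x among the parents: then Q + x is a (k+1)-clique of A *)
have no3 x : x \in A -> (forall q, q \in Q -> adj G q x) ->
    forall a b c, a \in A -> b \in A -> c \in A ->
    (forall q, q \in Q -> adj G q a) -> (forall q, q \in Q -> adj G q b) ->
    (forall q, q \in Q -> adj G q c) -> adj G x a -> adj G x b -> adj G x c ->
    a != b -> b != c -> c != a -> False.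
  move=> xA Qx a b c aA bA cA Qa Qb Qc xa xb xc ab bc ca.
  have [QA cxQ xk] := Qx_clique Q x QL cQ xA Qx.
  have := few _ QA cxQ; rewrite xk Qk leqNgt => /(_ erefl)/negP; apply.
  apply/card_gt2P; exists a, b, c; split=> //; split; rewrite inE.
  - by rewrite aA; apply/forall_inP=> q /setU1P[->//|/Qa].
  - by rewrite bA; apply/forall_inP=> q /setU1P[->//|/Qb].
  - by rewrite cA; apply/forall_inP=> q /setU1P[->//|/Qc].
have adjx x y : x \in A -> y \in A -> (d x).+1 = i -> (d y).+1 = i ->
    adj G q0 x -> adj G q0 y -> x != y -> adj G x y.
  move=> xA yA dx dy qx qy; have /levelP[qA dq] := subsetP QL _ q0Q.
  apply: (er.2 _ _ q0); rewrite 1?adj_sym //.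
    by apply: (layering_lt er lay); rewrite // dq -dx.
  by apply: (layering_lt er lay); rewrite // dq -dy.
have nzx z x : d z = i -> (d x).+1 = i -> z != x.
  by move=> dz dx; apply/eqP=> e; move: dx; rewrite -e dz => /esym/n_Sn.
(* in this pattern x2 sees z2, z3 and x1; in all others x1 sees z1 and, for
   j = 2, 3, the parent xj, or zj if xj = x1 *)
have [e23|n_e23] := eqVneq (x2, x1 != x2) (x3, true).
  case: e23 => e23 x12; subst x3.
  apply: (no3 x2 _ _ z2 z3 x1) => //; rewrite 1?adj_sym //.
  - by apply: adjx => //; [exact: Qx1|exact: Qx2].
  - exact: nzx.
  - by rewrite eq_sym nzx.
have [y2 [yA2 Qy2 xy2 y12 Ey2]] : exists y, [/\ y \in A,
    forall q, q \in Q -> adj G q y, adj G x1 y, z1 != y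
    & y = if x1 == x2 then z2 else x2].
  have [e|x12] := eqVneq x1 x2; [exists z2|exists x2]; split=> //.
  - by rewrite e adj_sym.
  - by apply: adjx => //; [exact: Qx1|exact: Qx2].
  - exact: nzx.
have [y3 [yA3 Qy3 xy3 y13 Ey3]] : exists y, [/\ y \in A,
    forall q, q \in Q -> adj G q y, adj G x1 y, z1 != y
    & y = if x1 == x3 then z3 else x3].
  have [e|x13] := eqVneq x1 x3; [exists z3|exists x3]; split=> //.
  - by rewrite e adj_sym.
  - by rewrite eq_sym.
  - by apply: adjx => //; [exact: Qx1|exact: Qx3].
  - exact: nzx.
apply: (no3 x1 _ _ z1 y2 y3) => //; rewrite 1?adj_sym // 1?eq_sym //.
rewrite {}Ey2 {}Ey3 eq_sym.
case: (eqVneq x1 x2) n_e23 => [<-|x12]; case: (eqVneq x1 x3) => [<-|x13] // n_e23.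
- exact: nzx.
- by rewrite eq_sym nzx.
- by apply: contra_neq n_e23 => ->.
Qed.

(** * Walks seen from a layer *)

(** Allowing a walk to pause lets an interior vertex be deleted from it
    as soon as its two neighbours on the walk are equal or adjacent. *)
Definition adjq (G : graph) : rel G := fun x y => (x == y) || adj G x y.

Lemma adjq_sym (G : graph) : symmetric (@adjq G).
Proof. by move=> x y; rewrite /adjq eq_sym adj_sym. Qed.

Lemma adjqW (G : graph) : subrel (adj G) (@adjq G).
Proof. by move=> x y xy; rewrite /adjq xy orbT. Qed.

(** The youngest interior vertex [w] can be deleted: its neighbours on
    the walk are older (interior ones by the choice of [w], end points because
    they are in a lower layer), hence equal or adjacent. *)
Lemma excursion (G : graph) (rho : G -> nat) (A : {set G}) (d : G -> nat) i
    (p : seq G) (x y : G) :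
  elimination_rank rho -> layering rho A d ->
  path (@adjq G) x (rcons p y) -> {subset x :: rcons p y <= A} ->
  d x = i -> d y = i -> (forall w, w \in p -> i < d w) -> adjq x y.
Proof.
move=> er lay; have [n] := ubnP (size p); elim: n => // n IHn in p *.
case: p => [|w0 p0] pn; first by case/andP.
have := mem_head w0 p0; move: (w0 :: p0) pn => p pn w0p pP pA dx dy dp.
pose w := [arg max_(z > w0 in p) rho z].
have [wp wmax] : w \in p /\ forall z, z \in p -> rho z <= rho w.
  by rewrite /w; case: arg_maxnP.
clearbody w; have dw := dp _ wp.
have wA : w \in A by apply: pA; rewrite inE mem_rcons inE wp !orbT.
have nbr a : a \in A -> (a \in p) || (d a == i) -> adjq w a -> a != w ->
    adj G a w /\ rho a < rho w.
  move=> aA ap wa aw; have aw' : adj G a w.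
    by move: wa; rewrite adjq_sym /adjq (negPf aw).
  split=> //; case/orP: ap => [ap|/eqP da].
    by rewrite ltn_neqAle wmax // andbT; apply: contra_neq aw => /er.1.
  by apply: (layering_lt er lay) => //; [rewrite adj_sym|rewrite da].
case/splitPr: p / wp {w0p wmax} pn pP pA dp nbr => p1 p2 pn pP pA dp nbr.
move: pP; rewrite rcons_cat rcons_cons cat_path /= => /and3P[xp1 aw wp2].
have bE : exists b t, rcons p2 y = b :: t.
  by case: (p2) => [|b t]; [exists y, [::]|exists b, (rcons t y)].
case: bE => b [t bt]; move: wp2; rewrite bt /= => /andP[wb bP].
have ab : adjq (last x p1) b.
  have [->//|naw] := eqVneq (last x p1) w.
  have [bw|nbw] := eqVneq b w; first by rewrite bw.
  have aA : last x p1 \in A.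
    by apply: pA; rewrite rcons_cat -cat_cons mem_cat mem_last.
  have bA : b \in A.
    apply: pA; rewrite rcons_cat rcons_cons bt inE mem_cat !inE eqxx.
    by rewrite !orbT.
  have [||aw' law] := nbr _ aA _ _ naw; last 1 first.
  - have [|bw' lbw] := nbr _ bA _ wb nbw.
      have : b \in rcons p2 y by rewrite bt mem_head.
      rewrite mem_rcons inE => /orP[/eqP->|bp2]; first by rewrite dy eqxx orbT.
      by rewrite mem_cat inE bp2 !orbT.
    have [->|nab] := eqVneq (last x p1) b; first by rewrite /adjq eqxx.
    by rewrite /adjq (er.2 _ _ _ aw' bw' law lbw nab) orbT.
  - have := mem_last x p1; rewrite inE => /orP[/eqP->|ap1].
      by rewrite dx eqxx orbT.
    by rewrite mem_cat ap1.
  - by rewrite adjq_sym.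
apply: (IHn (p1 ++ p2)) => //.
- by move: pn; rewrite !size_cat /= addnS.
- by rewrite rcons_cat cat_path xp1 bt /= ab.
- move=> z zp; apply: pA; move: zp; rewrite !rcons_cat !inE !mem_cat rcons_cons inE.
  by case/or3P=> ->; rewrite ?orbT.
- by move=> z zp; apply: dp; move: zp; rewrite !mem_cat inE => /orP[]->; rewrite ?orbT.
Qed.

Lemma level_entry (G : graph) (d : G -> nat) i (c : G) (p : seq G) :
  (forall w, w \in c :: p -> i <= d w) -> d (last c p) = i ->
  exists p1 p2, [/\ p = p1 ++ p2, d (last c p1) = i
    & forall w, w \in belast c p1 -> i < d w].
Proof.
elim: p c => [|b p IHp] c ge_i /= dl; first by exists [::], [::].
have [dc|dc] := eqVneq (d c) i; first by exists [::], (b :: p).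
have [|p1 [p2 [-> dp1 gt_i]]] := IHp b _ dl.
  by move=> w wp; apply: ge_i; rewrite inE wp orbT.
exists (b :: p1), p2; split=> // w; rewrite inE => /orP[/eqP->|/gt_i//].
by rewrite ltn_neqAle eq_sym dc ge_i ?mem_head.
Qed.

Lemma level_shortcut (G : graph) (rho : G -> nat) (A : {set G}) (d : G -> nat) i
    (v : G) (p : seq G) :
  elimination_rank rho -> layering rho A d ->
  path (adj G) v p -> {subset v :: p <= A} -> d v = i -> d (last v p) = i ->
  (forall w, w \in p -> i <= d w) ->
  exists p', [/\ path (adj G) v p', {subset v :: p' <= level A d i},
    last v p' = last v p, size p' <= size p & {subset p' <= p}].
Proof.
move=> er lay; have [n] := ubnP (size p); elim: n => // n IHn in p v *.
case: p => [|b p] pn vP pA dv dl ge_i.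
  exists [::]; split=> // x; rewrite inE => /eqP->; apply/levelP.
  by split=> //; apply: pA; rewrite mem_head.
move: vP => /= /andP[vb bP].
have [p1 [p2 [Ep dq gt_i]]] := level_entry ge_i dl.
set q := last b p1 in dq.
have bp1 : b :: p1 = rcons (belast b p1) q by rewrite -lastI.
have sub1 : {subset belast b p1 <= b :: p1} by apply: mem_belast.
have /andP[bp1P qP] : path (adj G) b p1 && path (adj G) q p2.
  by rewrite -cat_path -Ep.
have vq : adjq v q.
  apply: (excursion (p := belast b p1) er lay _ _ dv dq gt_i); rewrite -bp1.
    by apply: (sub_path (@adjqW G)); rewrite /= vb.
  by move=> z zp; apply: pA; rewrite Ep -2!cat_cons mem_cat zp.
have vA : v \in A by apply: pA; rewrite mem_head.
have vL : v \in level A d i by apply/levelP.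
have [||||p' [qP' p'L lp' sp' p'p]] := IHn p2 q _ qP _ dq.
- by move: pn; rewrite Ep /= size_cat; lia.
- move=> z zp; apply: pA; rewrite Ep -2!cat_cons mem_cat.
  move: zp; rewrite inE => /orP[/eqP->|->]; last by rewrite orbT.
  by rewrite [_ \in _ :: _]inE mem_last orbT.
- by rewrite -dl Ep /= last_cat.
- by move=> w wp; apply: ge_i; rewrite Ep inE mem_cat wp !orbT.
have p'sub : {subset p' <= b :: p}.
  by move=> z /p'p zp; rewrite Ep inE mem_cat zp !orbT.
have szp : size p' <= size p by rewrite Ep size_cat; lia.
have lE : last q p' = last v (b :: p) by rewrite lp' Ep /= last_cat.
have [vqE|nvq] := eqVneq v q.
  by exists p'; split; rewrite ?vqE // ?leqW // -vqE.
exists (q :: p'); split=> //.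
- by rewrite /= qP' andbT; move: vq; rewrite /adjq (negPf nvq).
- by move=> z; rewrite inE => /orP[/eqP->//|/p'L].
- move=> z; rewrite inE => /orP[/eqP->|/p'sub//].
  by rewrite Ep -cat_cons mem_cat mem_last.
Qed.

(** The vertices through which walks from [K] can first enter layer [i]. *)
Definition shadow (G : graph) (A : {set G}) (d : G -> nat) (i : nat)
    (K : {set G}) : {set G} :=
  [set q in level A d i | `[< exists c p, [/\ c \in K, path (adj G) c p,
     {subset c :: p <= A}, last c p = q & forall w, w \in belast c p -> i < d w]>]].

Lemma shadowP (G : graph) (A : {set G}) (d : G -> nat) i (K : {set G}) q :
  q \in shadow A d i K -> d q = i /\
   exists c p, [/\ c \in K, path (adj G) c p,
     {subset c :: p <= A}, last c p = q & forall w, w \in belast c p -> i < d w].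
Proof. by rewrite inE => /andP[/levelP[_ ->] /asboolP]. Qed.

(** Two walks that enter layer [i] for the first time at [q1] and [q2]
    start at equal or adjacent vertices; joined there, they form an
    excursion from [q1] to [q2]. *)
Lemma shadow_clique (G : graph) (rho : G -> nat) (A : {set G}) (d : G -> nat) i
    (K : {set G}) :
  elimination_rank rho -> layering rho A d -> clique K -> clique (shadow A d i K).
Proof.
move=> er lay cK q1 q2 /shadowP[dq1 [c1 [p1 [c1K c1P c1A lp1 gt1]]]].
move=> /shadowP[dq2 [c2 [p2 [c2K c2P c2A lp2 gt2]]]] nq.
suff : adjq q1 q2 by rewrite /adjq (negPf nq).
have lrev : last q1 (rev (belast c1 p1)) = c1.
  by case: (p1) lp1 => [|b t] //=; rewrite rev_cons last_rcons.
apply: (@excursion _ rho A d i (rev (belast c1 p1) ++ belast c2 p2)) => //.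
- rewrite rcons_cat -lp2 -lastI cat_path lrev /=; apply/and3P; split.
  + rewrite -lp1 rev_path; apply: sub_path c1P => x y xy.
    by rewrite adjq_sym; apply: adjqW.
  + by rewrite /adjq; case: eqVneq => //= nc; apply: cK.
  + exact: sub_path (@adjqW G) _ _ c2P.
- move=> z; rewrite inE rcons_cat -lp2 -lastI mem_cat mem_rev => /or3P[/eqP->|zp|zp].
  + by apply: c1A; rewrite -lp1 mem_last.
  + by apply: c1A; apply: mem_belast zp.
  + exact: c2A.
- by move=> w; rewrite mem_cat mem_rev => /orP[/gt1|/gt2].
Qed.

Lemma layering_dist (G : graph) (rho : G -> nat) (A : {set G}) (d : G -> nat)
    (c : G) (p : seq G) :
  elimination_rank rho -> layering rho A d ->
  path (adj G) c p -> {subset c :: p <= A} -> d c <= d (last c p) + size p.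
Proof.
move=> er lay; elim: p c => [|b p IHp] c /=; first by rewrite addn0.
move=> /andP[cb bP] pA; rewrite addnS.
have cdb : d c <= (d b).+1.
  by apply: (layering_step er lay _ _ cb); apply: pA; rewrite !inE eqxx ?orbT.
apply: leq_trans cdb _; rewrite ltnS; apply: IHp => // z zp.
by apply: pA; rewrite inE zp orbT.
Qed.

(** The order inside a block of equal keys may depend on the block. *)
Definition lex_order (T : Type) (key : T -> nat) (le : nat -> rel T) : rel T :=
  fun x y => (key x < key y) || (key x == key y) && le (key x) x y.

Lemma lex_linear (T : Type) (key : T -> nat) (le : nat -> rel T) :
  (forall i, linear_order (le i)) -> linear_order (lex_order key le).
Proof.
move=> lin; rewrite /lex_order; split.
- by move=> x; rewrite ltnn eqxx; have [->] := lin (key x).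
- move=> x y; have [_ anti _ _] := lin (key x).
  by case: (ltngtP (key x)) => //= e; rewrite -e; apply: anti.
- move=> y x z; have [_ _ trans _] := lin (key x).
  case: (ltngtP (key x)) => //= xy; last rewrite -xy.
    by move=> _; case: (ltngtP (key y)) => //= [yz|<-]; rewrite ?xy ?(ltn_trans xy).
  by case: (ltngtP (key x)) => //= _; apply: trans.
- move=> x y; have [_ _ _ tot] := lin (key x).
  by case: (ltngtP (key x)) => //= e; rewrite -e; apply: tot.
Qed.

Lemma lex_order_key (T : Type) (key : T -> nat) (le : nat -> rel T) x y :
  lex_order key le x y -> key x <= key y.
Proof. by case/orP=> [/ltnW//|/andP[/eqP->]]. Qed.

(** The heart of the upper bound.  Since [u] is minimal on the walk, the walk
    never goes below layer [i]; it enters this layer in the shadow, after at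
    least [e] steps, and the rest of it can be pushed into the layer. *)
Lemma reach_level (G : graph) (rho : G -> nat) (A : {set G}) (d : G -> nat)
    (le : nat -> rel G) i e s (K : {set G}) u :
  elimination_rank rho -> layering rho A d ->
  d u = i -> (forall c, c \in K -> i <= d c -> i + e <= d c) ->
  u \in reach_set A (lex_order d le) s K ->
  e <= s /\ u \in reach_set (level A d i) (le i) (s - e) (shadow A d i K).
Proof.
move=> er lay du Kge /reach_setP[c cK [p [cP pA lp sp pmin]]].
have ge_i w : w \in c :: p -> i <= d w.
  by move=> wp; have := lex_order_key (pmin w wp); rewrite du.
have dl : d (last c p) = i by rewrite lp.
have [p1 [p2 [Ep dq gt_i]]] := level_entry ge_i dl.
set q := last c p1 in dq.
have /andP[cP1 qP] : path (adj G) c p1 && path (adj G) q p2.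
  by rewrite -cat_path -Ep.
have sub1 : {subset c :: p1 <= c :: p}.
  by move=> z zp; rewrite Ep -cat_cons mem_cat zp.
have qp : q \in c :: p by apply: sub1; apply: mem_last.
have sub2 : {subset p2 <= p} by move=> z zp; rewrite Ep mem_cat zp orbT.
have lq : last q p2 = u by rewrite -lp Ep last_cat.
have := layering_dist er lay cP1 (fun z zp => pA z (sub1 z zp)).
rewrite -/q dq => cq; have ce := Kge c cK (ge_i c (mem_head _ _)).
have spE : size p = size p1 + size p2 by rewrite Ep size_cat.
have e1 : e <= size p1 by move: (leq_trans ce cq); rewrite leq_add2l.
have [|||p' [qP' p'L lp' sp' p'p]] := level_shortcut er lay qP _ dq.
- move=> z; rewrite inE => /orP[/eqP->|/sub2 zp]; apply: pA => //.
  by rewrite inE zp orbT.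
- by rewrite lq.
- by move=> w /sub2 wp; apply: ge_i; rewrite inE wp orbT.
split; first by apply: leq_trans e1 (leq_trans _ sp); rewrite spE leq_addr.
have qL : q \in level A d i by apply: p'L; rewrite mem_head.
apply/reach_setP; exists q.
  rewrite inE qL; apply/asboolP; exists c, p1; split=> // z zp.
  exact: pA (sub1 z zp).
exists p'; split=> //; first by rewrite lp'.
- apply: leq_trans sp' _; rewrite leq_subRL; last first.
    by apply: leq_trans e1 (leq_trans _ sp); rewrite spE leq_addr.
  by apply: leq_trans sp; rewrite spE leq_add2r.
- move=> w wp; have /levelP[_ dw] := p'L _ wp.
  have /pmin : w \in c :: p.
    move: wp; rewrite inE => /orP[/eqP->//|/p'p/sub2 wp].
    by rewrite inE wp orbT.
  by rewrite /lex_order du dw ltnn eqxx.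
Qed.

(** In its own layer a vertex is its whole shadow: there the bound for single
    vertices applies again, not the weaker one for cliques. *)
Lemma shadow1 (G : graph) (A : {set G}) (d : G -> nat) (v : G) :
  shadow A d (d v) [set v] \subset [set v].
Proof.
apply/subsetP=> q /shadowP[_ [c [p [/set1P-> _ _ <-]]]].
case: p => [|b p] gt_i; first exact: set11.
by have := gt_i v (mem_head _ _); rewrite ltnn.
Qed.

(** * Counting over the layers *)

(** Applied with keys that number the layers from the highest one downwards,
    so that the walk budget bounds the keys. *)
Lemma card_by_key (T : finType) (X : {set T}) (key : T -> nat) s (b : nat -> nat) :
  (forall x, x \in X -> key x <= s) ->
  (forall t, t <= s -> #|[set x in X | key x == t]| <= b t) ->
  #|X| <= \sum_(t < s.+1) b t.
Proof.
move=> Xs Xb; rewrite -sum1_card.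
rewrite (partition_big (fun x => inord (key x) : 'I_s.+1) xpredT) //=.
apply: leq_sum => t _; apply: leq_trans (Xb t _); last by rewrite -ltnS.
rewrite sum1dep_card; apply: subset_leq_card; apply/subsetP=> x.
by rewrite !inE => /andP[xX /eqP<-]; rewrite xX inordK ?eqxx // ltnS Xs.
Qed.

(** The value 4 L (t+1)^n alone is not preserved by the recursion, and the
    trivial bound n+2 at t = 0 exceeds it when n is large and L is small;
    subtracting L (n+3) makes room for that term. *)
Definition clique_bound (L n t : nat) : nat :=
  if t == 0 then n + 2 else 4 * L * t.+1 ^ n - L * (n + 3).

Lemma expn_room n t : 0 < t -> n + 3 <= 4 * t.+1 ^ n.
Proof.
move=> t_gt0; elim: n => [//|n IHn]; rewrite expnS.
by move: IHn t_gt0; move: (t.+1 ^ n) => a; nia.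
Qed.

Lemma clique_boundE L n t : 0 < t ->
  clique_bound L n t + L * (n + 3) = 4 * L * t.+1 ^ n.
Proof.
move=> t_gt0; rewrite /clique_bound eqn0Ngt t_gt0 /= subnK //.
by rewrite [4 * L]mulnC -mulnA leq_mul2l expn_room ?orbT.
Qed.

(** All terms with t > 0 are replaced by the last one. *)
Lemma sum_clique_bound L n s : 0 < s ->
  \sum_(t < s.+1) clique_bound L n t + s * (L * (n + 3))
    <= 4 * L * (s * s.+1 ^ n) + (n + 2).
Proof.
move=> s_gt0; rewrite big_ord_recl /= {1}/clique_bound /=.
have : \sum_(i < s) (clique_bound L n (lift ord0 i) + L * (n + 3))
    <= \sum_(i < s) 4 * L * s.+1 ^ n.
  apply: leq_sum => i _; rewrite clique_boundE // leq_mul2l.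
  by case: (n) => [|m]; rewrite ?expn0 ?leq_exp2r ?lift0 ?ltnS ?ltn_ord ?orbT.
rewrite big_split /= !sum_nat_const card_ord; lia.
Qed.

(** Here [n] is k-1.  The bound for cliques feeds the induction and stays
    below distance [r]; the bound for single vertices at distance [r] is
    the one sought.  Distance 0 is left out because only the size of the
    clique matters there. *)
Definition good_order (G : graph) (L r n : nat) (A : {set G}) (le : rel G) : Prop :=
  [/\ linear_order le,
      forall v, v \in A -> #|reach_set A le r [set v]| <= 4 * L * r ^ n
    & forall (K : {set G}) s, K \subset A -> clique K -> 0 < s < r ->
        #|reach_set A le s K| <= clique_bound L n s].

Lemma leq_card_split (T : finType) (X D : {set T}) a b :
  #|X :&: D| <= a -> #|X :\: D| <= b -> #|X| <= a + b.
Proof. by move=> Xa Xb; rewrite -(cardsID D X) leq_add. Qed.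

Lemma good_order_level (G : graph) (A : {set G}) L r n (le : rel G)
    (K : {set G}) t :
  thin n.+1 A -> good_order L r n A le -> K \subset A -> clique K -> t < r ->
  #|reach_set A le t K| <= clique_bound L n t.
Proof.
move=> [small _] [_ _ cb] KA cK tr; case: (posnP t) => [->|t_gt0].
  rewrite /clique_bound /= addn2.
  exact: leq_trans (subset_leq_card (reach_set0 _ _ _)) (small _ KA cK).
by apply: cb; rewrite // t_gt0.
Qed.

(** A clique spans at most two consecutive layers J-1 and J.  With
    budget s, layers J and J-1 are seen with budget s, and layer J-1-t with
    budget s-t.  From a single vertex of layer J with budget r, layer J-1-t is
    seen with budget r-1-t, so that only clique bounds below r occur. *)
Lemma good_order_step (G : graph) (rho : G -> nat) (A : {set G}) (d : G -> nat)
    L r n :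
  elimination_rank rho -> layering rho A d -> thin n.+2 A -> 1 < r -> 0 < L ->
  (forall i, exists le, good_order L r n (level A d i) le) ->
  exists le, good_order L r n.+1 A le.
Proof.
move=> er lay thA r_gt1 L_gt0 /choice[le leP].
have cbL i t (K : {set G}) : clique K -> K \subset level A d i -> t < r ->
    #|reach_set (level A d i) (le i) t K| <= clique_bound L n t.
  by move=> cK KL; apply: good_order_level => //; apply: thin_level er lay _ thA.
have shL i K : shadow A d i K \subset level A d i.
  by apply/subsetP=> q; rewrite inE => /andP[].
have key_le s (K : {set G}) J u : (forall c, c \in K -> d c <= J) ->
    u \in reach_set A (lex_order d le) s K -> d u <= J.
  move=> KJ /reach_setP[c cK [p [_ _ _ _ pmin]]].
  exact: leq_trans (lex_order_key (pmin c (mem_head _ _))) (KJ c cK).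
exists (lex_order d le); split.
- by apply: lex_linear => i; case: (leP i).
- move=> v vA; set X := reach_set _ _ _ _.
  have XJ u : u \in X -> d u <= d v.
    by apply: key_le => c /set1P->.
  have lower u : u \in X :\: level A d (d v) -> d u < d v.
    move=> /setDP[uX]; rewrite ltn_neqAle XJ // andbT; apply: contra => /eqP du.
    by apply/levelP; split=> //; apply: (subsetP (reach_set_sub _ _ _ _)) uX.
  have below u : u \in X :\: level A d (d v) ->
      (d v).-1 - d u <= r.-1 /\
      u \in reach_set (level A d (d u)) (le (d u)) (r.-1 - ((d v).-1 - d u))
              (shadow A d (d u) [set v]).
    move=> uX; have du := lower u uX; case/setDP: uX => uX _.
    have [|h1 h2] := reach_level (e := d v - d u) er lay (erefl (d u)) _ uX.
      by move=> c /set1P-> _; rewrite subnKC // ltnW.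
    split; first lia.
    by have -> : r.-1 - ((d v).-1 - d u) = r - (d v - d u) by lia.
  apply: (@leq_trans (4 * L * r ^ n +
      \sum_(t < r.-1.+1) clique_bound L n (r.-1 - t))).
    apply: (leq_card_split (D := level A d (d v))).
      have [_ /(_ v) vb _] := leP (d v).
      apply: leq_trans (vb _); last by apply/levelP.
      apply: subset_leq_card; apply/subsetP=> u /setIP[uX /levelP[_ du]].
      have [|_ ] := reach_level (e := 0) er lay du _ uX.
        by move=> c _; rewrite addn0.
      by rewrite subn0; apply: (subsetP (reach_setS _ _ _ (shadow1 _ _ _))).
    apply: (@card_by_key _ _ (fun u => (d v).-1 - d u) _
             (fun t => clique_bound L n (r.-1 - t))) => [u /below[]//|t tr].
    apply: leq_trans (cbL ((d v).-1 - t) (r.-1 - t)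
                 (shadow A d ((d v).-1 - t) [set v]) _ _ _).
    + apply: subset_leq_card; apply/subsetP=> u; rewrite inE => /andP[uX /eqP et].
      have [_] := below u uX; have := lower u uX.
      by rewrite et => lt; have -> : d u = (d v).-1 - t by lia.
    + by apply: shadow_clique er lay _ => x y /set1P-> /set1P->; rewrite eqxx.
    + exact: shL.
    + lia.
  rewrite (reindex_inj rev_ord_inj) /=.
  under eq_bigr => t _ do rewrite subSS subKn -1?ltnS //.
  have r1_gt0 : 0 < r.-1 by lia.
  have := sum_clique_bound L n r1_gt0; rewrite prednK; last lia.
  have -> : 4 * L * r ^ n.+1 = 4 * L * r ^ n + 4 * L * (r.-1 * r ^ n).
    by rewrite -mulnDr -mulSn prednK -?expnS // ltnW.
  (* pays for the clique bound at t = 0 in the sum *)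
  have room : n + 2 <= r.-1 * (L * (n + 3)) by case: (r) r_gt1 => [|[|q]] //= _; nia.
  rewrite leq_add2l; move: (bigop _ _ _) => S; lia.
- move=> K s KA cK /andP[s_gt0 sr].
  have [->|[c0 c0K]] := set_0Vmem K.
    rewrite (_ : reach_set _ _ _ _ = set0) ?cards0 //.
    by apply/setP=> u; rewrite in_set0; apply/reach_setP=> -[c]; rewrite inE.
  pose m := [arg max_(x > c0 in K) d x].
  have [mK mmax] : m \in K /\ forall x, x \in K -> d x <= d m.
    by rewrite /m; case: arg_maxnP.
  clearbody m; have dK c : c \in K -> d m <= (d c).+1.
    move=> cK'; have [->|mc] := eqVneq m c; first exact: leqnSn.
    by apply: (layering_step er lay); rewrite ?(subsetP KA) //; apply: cK.
  set X := reach_set _ _ _ _.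
  have XJ u : u \in X -> d u <= d m by apply: key_le.
  have lower u : u \in X :\: level A d (d m) -> d u < d m.
    move=> /setDP[uX]; rewrite ltn_neqAle XJ // andbT; apply: contra => /eqP du.
    by apply/levelP; split=> //; apply: (subsetP (reach_set_sub _ _ _ _)) uX.
  have below u : u \in X :\: level A d (d m) ->
      (d m).-1 - d u <= s /\
      u \in reach_set (level A d (d u)) (le (d u)) (s - ((d m).-1 - d u))
              (shadow A d (d u) K).
    move=> uX; have du := lower u uX; case/setDP: uX => uX _.
    apply: (reach_level er lay (erefl (d u)) _ uX) => c /dK; lia.
  apply: (@leq_trans (clique_bound L n s +
      \sum_(t < s.+1) clique_bound L n (s - t))).
    apply: (leq_card_split (D := level A d (d m))).
      apply: leq_trans (cbL (d m) s (shadow A d (d m) K) _ _ _) => //.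
      - apply: subset_leq_card; apply/subsetP=> u /setIP[uX /levelP[_ du]].
        have [|_ ] := reach_level (e := 0) er lay du _ uX.
          by move=> c _; rewrite addn0.
        by rewrite subn0.
      - exact: shadow_clique er lay _.
    apply: (@card_by_key _ _ (fun u => (d m).-1 - d u) _
             (fun t => clique_bound L n (s - t))) => [u /below[]//|t ts].
    apply: leq_trans (cbL ((d m).-1 - t) (s - t)
                 (shadow A d ((d m).-1 - t) K) _ _ _).
    + apply: subset_leq_card; apply/subsetP=> u; rewrite inE => /andP[uX /eqP et].
      have [_] := below u uX; have := lower u uX.
      by rewrite et => lt; have -> : d u = (d m).-1 - t by lia.
    + exact: shadow_clique er lay _.
    + exact: shL.
    + lia.
  rewrite (reindex_inj rev_ord_inj) /=.
  under eq_bigr => t _ do rewrite subSS subKn -1?ltnS //.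
  have := sum_clique_bound L n s_gt0; have := clique_boundE L n s_gt0.
  have := clique_boundE L n.+1 s_gt0.
  have room : L + (n + 2) <= s * (L * (n + 3)) by nia.
  rewrite expnS; move: (bigop _ _ _) => S. lia.
Qed.

(** * Paths and the ruler order *)

Lemma thin1_nbrs (G : graph) (A : {set G}) u x y z : thin 1 A ->
  u \in A -> x \in A -> y \in A -> z \in A ->
  adj G u x -> adj G u y -> adj G u z -> x != y -> y != z -> z != x -> False.
Proof.
move=> [_ few] uA xA yA zA ux uy uz xy yz zx.
have := few [set u]; rewrite sub1set uA cards1 leqNgt => /(_ isT _ erefl)/negP.
apply; first by move=> a b /set1P-> /set1P->; rewrite eqxx.
apply/card_gt2P; exists x, y, z; split=> //; split; rewrite inE ?xA ?yA ?zA /=.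
- by apply/forall_inP=> q /set1P->.
- by apply/forall_inP=> q /set1P->.
- by apply/forall_inP=> q /set1P->.
Qed.

Lemma thin1_triangle (G : graph) (A : {set G}) x y z : thin 1 A ->
  x \in A -> y \in A -> z \in A -> adj G x y -> adj G y z -> adj G z x -> False.
Proof.
move=> [small _] xA yA zA xy yz zx.
have ne a b : adj G a b -> a != b by apply: contraTneq => ->; rewrite adj_irrefl.
have := small [set x; y; z]; rewrite !subUset !sub1set xA yA zA => /(_ isT).
have -> : #|[set x; y; z]| = 3.
  apply/eqP; rewrite eqn_leq; apply/andP; split; last first.
    apply/card_gt2P; exists x, y, z; rewrite !inE !eqxx !orbT; split=> //.
    by split; apply: ne.
  apply: leq_trans (leq_card_setU _ _) _; rewrite cards1 cards2.
  by case: (x != y).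
suff c3 : clique [set x; y; z] by move/(_ c3).
move=> a b; rewrite !inE -!orbA => /or3P[]/eqP-> /or3P[]/eqP->; rewrite ?eqxx // => _;
  by rewrite // adj_sym.
Qed.

(** The graph is a union of paths, laid out one after the other:
    non-adjacent vertices may occupy consecutive positions, but adjacent
    ones must.  The youngest vertex has at most one neighbour [u], which has
    at most one other, so it can be inserted next to [u] on a side where no
    edge is cut. *)
Lemma line_layout (G : graph) (rho : G -> nat) (A : {set G}) :
  elimination_rank rho -> thin 1 A ->
  exists pos : G -> nat, {in A &, injective pos} /\
    {in A &, forall x y, adj G x y -> pos x = (pos y).+1 \/ pos y = (pos x).+1}.
Proof.
move=> er; elim: {A}#|A| {-2}A (erefl #|A|) => [|n IHn] A An thA.
  by exists (fun=> 0); split=> x y; rewrite (cards0_eq An) inE.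
have /card_gt0P[x0 x0A] : 0 < #|A| by rewrite An.
pose v := [arg max_(x > x0 in A) rho x].
have [vA vmax] : v \in A /\ forall x, x \in A -> rho x <= rho v.
  by rewrite /v; case: arg_maxnP.
clearbody v.
have vlt x : x \in A -> x != v -> rho x < rho v.
  move=> xA xv; rewrite ltn_neqAle vmax // andbT.
  by apply: contra_neq xv => /er.1.
have inB x : x \in A -> x != v -> x \in A :\ v by move=> xA xv; rewrite !inE xv.
have nv y : adj G v y -> y != v by apply: contraTneq => ->; rewrite adj_irrefl.
case: (IHn (A :\ v)) => [||pos [inj step]].
- by move: (cardsD1 v A); rewrite vA An => -[].
- exact: thin_sub (subsetDl _ _) thA.
have [/existsP[u /andP[uA vu]]|/existsPn no_nbr] :=
    boolP [exists u, (u \in A) && adj G v u]; last first.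
  have none x : x \in A -> adj G v x = false.
    by move=> xA; apply/negP=> vx; have := no_nbr x; rewrite xA vx.
  exists (fun x => if x == v then (\max_(y : G) pos y).+1 else pos x).
  have lt x : pos x < (\max_(y : G) pos y).+1 by rewrite ltnS leq_bigmax.
  split=> x y xA yA; case: (eqVneq x v) => [->|xv]; case: (eqVneq y v) => [->|yv] //.
  - by move=> e; have := lt y; rewrite -e ltnn.
  - by move=> e; have := lt x; rewrite e ltnn.
  - by apply: inj; apply: inB.
  - by rewrite adj_irrefl.
  - by rewrite none.
  - by rewrite adj_sym none.
  - by apply: step; apply: inB.
have uniq_nbr y : y \in A -> adj G v y -> y = u.
  move=> yA vy; apply: contrapT => /eqP yu.
  have uy : adj G u y.
    by apply: (er.2 _ _ v); rewrite 1?adj_sym 1?eq_sym // vlt // nv.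
  by apply: (thin1_triangle thA vA uA yA vu uy); rewrite adj_sym.
have uv := nv _ vu.
(* positions from p on are shifted: an edge is cut only if it ends at p *)
have [p [pP pnbr]] : exists p, (p = pos u \/ p = (pos u).+1) /\
    forall x y, x \in A :\ v -> y \in A :\ v -> adj G x y ->
      pos y = (pos x).+1 -> pos y != p.
  have [/existsP[z /andP[zB /andP[uz /eqP zp]]]|/existsPn nz] :=
      boolP [exists z, (z \in A :\ v) && (adj G u z && (pos z == (pos u).+1))].
    exists (pos u); split; [by left|move=> x y xB yB xy yx].
    apply/eqP=> e; have eu : y = u by apply: inj => //; apply: inB.
    subst y; move: xB zB; rewrite !inE => /andP[xv xA] /andP[zv zA].
    apply: (@thin1_nbrs _ _ u x z v thA) => //; rewrite 1?adj_sym // 1?eq_sym //.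
    by apply/eqP=> zx; move: zp yx; rewrite zx; clear; lia.
  exists (pos u).+1; split; [by right|move=> x y xB yB xy yx].
  apply/eqP; rewrite yx => -[e]; have eu : x = u by apply: inj => //; apply: inB.
  by subst x; have := nz y; rewrite yB xy yx eqxx.
exists (fun x => if x == v then p else if pos x < p then pos x else (pos x).+1).
split=> x y xA yA.
  case: (eqVneq x v) => [->|xv]; case: (eqVneq y v) => [->|yv] //.
  - by clear; case: ifP; lia.
  - by clear; case: ifP; lia.
  - by move=> e; apply: inj; rewrite ?inB //; move: e; clear; case: ifP; case: ifP; lia.
have nbrv z : z \in A -> adj G v z ->
    p = (if pos z < p then pos z else (pos z).+1).+1 \/
    (if pos z < p then pos z else (pos z).+1) = p.+1.
  move=> zA vz; rewrite (uniq_nbr z zA vz); case: pP => ->; rewrite ?ltnn; first by right.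
  by rewrite ltnS leqnn; left.
case: (eqVneq x v) => [->|xv]; case: (eqVneq y v) => [->|yv].
- by rewrite adj_irrefl.
- exact: nbrv.
- by rewrite adj_sym => /(nbrv _ xA); case; [right|left].
move=> xy; have yx : adj G y x by rewrite adj_sym.
have xB := inB _ xA xv; have yB := inB _ yA yv.
have := pnbr x y xB yB xy; have := pnbr y x yB xB yx.
case: (step x y xB yB xy); clear; case: ifP; case: ifP; lia.
Qed.

(** Two multiples of 2^m that are not multiples of 2^(m+1) are separated by
    a multiple of 2^(m+1).  Capping valuations at [c] identifies those that
    occur at most once in any interval of length [s]. *)
Lemma ruler_between a b s c : 0 < a < b -> b - a <= s -> s < 2 ^ c ->
  minn (logn 2 a) c = minn (logn 2 b) c ->
  exists t, [/\ a < t < b, logn 2 a < logn 2 t & logn 2 b < logn 2 t].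
Proof.
move=> /andP[a_gt0 ab] bs sc e; have b_gt0 : 0 < b by apply: leq_trans ab.
have [ca|ac] := leqP c (logn 2 a).
  have cb : c <= logn 2 b by move: e; lia.
  have : 2 ^ c %| b - a by rewrite dvdn_sub // pfactor_dvdn.
  by move/dvdn_leq; rewrite subn_gt0 => /(_ ab); lia.
have {e} e : logn 2 b = logn 2 a by move: e; lia.
have [a' oa Ea] := pfactor_coprime (isT : prime 2) a_gt0.
have [b' ob Eb] := pfactor_coprime (isT : prime 2) b_gt0.
rewrite !coprime2n in oa ob.
set m := logn 2 a in Ea e ac *; rewrite e in Eb *.
have m_gt0 : 0 < 2 ^ m by rewrite expn_gt0.
have ab' : a' < b' by rewrite -(ltn_pmul2r m_gt0) -Ea -Eb.
have ab'' : a'.+1 < b'.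
  rewrite ltn_neqAle ab' andbT; apply/eqP=> eb; move: ob.
  by rewrite -eb /= oa.
have lt : m < logn 2 (a'.+1 * 2 ^ m).
  rewrite -pfactor_dvdn ?muln_gt0 ?m_gt0 // expnS dvdn_pmul2r // dvdn2 /=.
  by rewrite oa.
exists (a'.+1 * 2 ^ m); split=> //.
by rewrite [X in X < _]Ea [X in _ && (_ < X)]Eb !ltn_pmul2r // ltnSn.
Qed.

Lemma linear_order_rev (T : Type) (le : rel T) :
  linear_order le -> linear_order (fun x y => le y x).
Proof.
case=> refl anti trans tot; split=> //.
- by move=> x y; rewrite andbC; apply: anti.
- by move=> y x z yx zy; apply: trans zy yx.
Qed.

Lemma layout_dist (G : graph) (A : {set G}) (pos : G -> nat) v p :
  {in A &, forall x y, adj G x y -> pos x = (pos y).+1 \/ pos y = (pos x).+1} ->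
  path (adj G) v p -> {subset v :: p <= A} ->
  pos v <= pos (last v p) + size p /\ pos (last v p) <= pos v + size p.
Proof.
move=> step; elim: p v => [|b p IHp] v /=; first by rewrite addn0.
move=> /andP[vb bP] pA; have [|] := IHp b bP.
  by move=> z zp; apply: pA; rewrite inE zp orbT.
by case: (step v b _ _ vb); rewrite ?pA ?inE ?eqxx ?orbT // => ->; lia.
Qed.

(** A walk moves by one position at a time, so it skips no position. *)
Lemma layout_between (G : graph) (A : {set G}) (pos : G -> nat) v p t :
  {in A &, forall x y, adj G x y -> pos x = (pos y).+1 \/ pos y = (pos x).+1} ->
  path (adj G) v p -> {subset v :: p <= A} ->
  minn (pos v) (pos (last v p)) <= t <= maxn (pos v) (pos (last v p)) ->
  exists2 w, w \in v :: p & pos w = t.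
Proof.
move=> step; elim: p v => [|b p IHp] v /=.
  by rewrite minnn maxnn -eqn_leq => _ _ /eqP<-; exists v; rewrite ?inE.
move=> /andP[vb bP] pA ht; have [->|vt] := eqVneq t (pos v).
  by exists v; rewrite ?mem_head.
have [||w wp wt] := IHp b bP.
- by move=> z zp; apply: pA; rewrite inE zp orbT.
- move: ht vt; case: (step v b _ _ vb); rewrite ?pA ?inE ?eqxx ?orbT // => ->; lia.
by exists w; rewrite // inE wp orbT.
Qed.

(** Positions with a high power of 2 come first, as on the marks of a
    ruler; numbering starts at 1 because 0 has no valuation. *)
Definition ruler_order (G : graph) (pos : G -> nat) : rel G := fun x y =>
  lex_order (fun z => logn 2 (pos z).+1)
    (fun _ x y => enum_rank x <= enum_rank y) y x.

Lemma ruler_linear (G : graph) (pos : G -> nat) : linear_order (ruler_order pos).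
Proof.
apply: linear_order_rev; apply: lex_linear => i; split.
- by move=> x; apply: leqnn.
- by move=> x y; rewrite -eqn_leq => /eqP/val_inj/enum_rank_inj.
- by move=> y x z; apply: leq_trans.
- by move=> x y; apply: leq_total.
Qed.

(** On each side of [v], the capped valuation is injective on the reachable
    vertices: two equal values would leave a vertex of higher valuation between
    them, which the walk to the farther one crosses. *)
Lemma ruler_reach (G : graph) (A : {set G}) (pos : G -> nat) s v :
  {in A &, injective pos} ->
  {in A &, forall x y, adj G x y -> pos x = (pos y).+1 \/ pos y = (pos x).+1} ->
  #|reach_set A (ruler_order pos) s [set v]| <= 2 * (trunc_log 2 s + 2).
Proof.
move=> inj step; move Xdef: (reach_set _ _ _ _) => X; pose val x := logn 2 (pos x).+1.
have XP u : u \in X -> [/\ u \in A, pos u <= pos v + s, pos v <= pos u + s &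
    forall t, minn (pos v) (pos u) <= t <= maxn (pos v) (pos u) ->
      logn 2 t.+1 <= val u].
  rewrite -Xdef => /reach_setP[c /set1P-> [p [vP pA lp sp pmin]]].
  have [h1 h2] := layout_dist step vP pA; rewrite lp in h1 h2.
  split; [by rewrite -lp pA ?mem_last|lia|lia|move=> t tP].
  rewrite -lp in tP; have [w /pmin uw <-] := layout_between step vP pA tP.
  exact: lex_order_key uw.
(* 2^c > s: on each side of v, at most one reachable vertex has valuation
   c or more *)
pose c := (trunc_log 2 s).+1; have sc : s < 2 ^ c by apply: trunc_log_ltn.
have ordered x y : x \in X -> y \in X -> minn (val x) c = minn (val y) c ->
    (pos v <= pos x) = (pos v <= pos y) -> pos x < pos y -> False.
  move=> /XP[xA x1 x2 xmax] /XP[yA y1 y2 ymax] e side xy.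
  have [||t [/andP[xt ty] vx vy]] := ruler_between _ _ sc e; [by rewrite ltnS|lia|].
  have t_gt0 : t = t.-1.+1 by lia.
  case: (leqP (pos v) (pos x)) side => [vx' /esym vy'|vx' /esym/negbT].
    by have := ymax t.-1; rewrite -t_gt0 /val; lia.
  by rewrite -ltnNge => vy'; have := xmax t.-1; rewrite -t_gt0 /val; lia.
have half (b : bool) : #|[set x in X | (pos v <= pos x) == b]| <= trunc_log 2 s + 2.
  apply: leq_trans (@card_by_key _ _ (fun u => minn (val u) c) c (fun=> 1) _ _) _.
  - by move=> x _; rewrite geq_minr.
  - move=> t _; apply/card_le1_eqP=> x y; rewrite !inE.
    move=> /andP[/andP[xX /eqP xb] /eqP xt] /andP[/andP[yX /eqP yb] /eqP yt].
    have [xA _ _ _] := XP x xX; have [yA _ _ _] := XP y yX.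
    case: (ltngtP (pos x) (pos y)) => [xy|yx|/(inj _ _ xA yA)//].
      by case: (ordered x y); rewrite ?xt ?yt ?xb ?yb.
    by case: (ordered y x); rewrite ?xt ?yt ?xb ?yb.
  - by rewrite sum_nat_const card_ord muln1 /c addn2.
rewrite mul2n -addnn; apply: (leq_card_split (D := [set x | pos v <= pos x])).
  apply: leq_trans (half true); apply: subset_leq_card; apply/subsetP=> x.
  by rewrite !inE => /andP[-> ->].
apply: leq_trans (half false); apply: subset_leq_card; apply/subsetP=> x.
by rewrite !inE => /andP[/negPf-> ->].
Qed.

(** The factor 4 covers two sides for each of the two ends of an edge. *)
Lemma good_order_line (G : graph) (rho : G -> nat) (A : {set G}) r :
  elimination_rank rho -> thin 1 A ->
  exists le, good_order (4 * (trunc_log 2 r + 2)) r 0 A le.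
Proof.
move=> er thA; have [pos [inj step]] := line_layout er thA.
exists (ruler_order pos); split; first exact: ruler_linear.
  by move=> v _; apply: leq_trans (ruler_reach r v inj step) _; lia.
move=> K s KA cK /andP[s_gt0 sr].
have cbE : clique_bound (4 * (trunc_log 2 r + 2)) 0 s = 4 * (trunc_log 2 r + 2).
  by rewrite /clique_bound eqn0Ngt s_gt0 /= expn0; lia.
rewrite cbE (@leq_trans (#|K| * (2 * (trunc_log 2 r + 2)))) //.
  apply: card_reach_set => v _; apply: leq_trans (ruler_reach s v inj step) _.
  by rewrite leq_mul2l leq_add2r leq_trunc_log // ltnW.
by rewrite -[4]/(2 * 2) -mulnA leq_mul2r thA.1 ?orbT.
Qed.

(** * The upper bound *)

Lemma good_order_exists (G : graph) (rho : G -> nat) r n (A : {set G}) :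
  elimination_rank rho -> 1 < r -> thin n.+1 A ->
  exists le, good_order (4 * (trunc_log 2 r + 2)) r n A le.
Proof.
move=> er r_gt1; elim: n A => [|n IHn] A thA; first exact: good_order_line er thA.
have [d lay] := layering_exists A er.
apply: (good_order_step er lay thA r_gt1) => [|i]; first by lia.
by apply: IHn; apply: thin_level er lay _ thA.
Qed.

Lemma wcol_simple_ktree k n r (G : graph) :
  simple_ktree k G -> k <= n.+1 -> 1 < r ->
  wcol r G <= 16 * (trunc_log 2 r + 2) * r ^ n.
Proof.
move=> /simple_ktree_thin[rho er thk] kn r_gt1.
have [le [lin vb _]] := good_order_exists er r_gt1 (thin_leq kn thk).
apply: wcol_le lin _ => v; rewrite WReachE (leq_trans (vb v _)) ?in_setT //.
by rewrite mulnA.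
Qed.

Lemma stwP (G : graph) : exists2 H, simple_ktree (stw G) H & subgraph G H.
Proof. by have [[H tH GH] _] := min_natP (stw_subproof G); exists H. Qed.

Lemma wcol_stw n r (G : graph) : stw G <= n.+1 -> 1 < r ->
  wcol r G <= 16 * (trunc_log 2 r + 2) * r ^ n.
Proof.
have [H tH GH] := stwP G => Gn r_gt1.
exact: leq_trans (wcol_subgraph r GH) (wcol_simple_ktree tH Gn r_gt1).
Qed.

(** * The graph of words *)

(** The word [w], read from its last letter, encodes a sequence of choices:
    starting from the clique of the k roots [inl i], letter [a] replaces the
    vertex number [a] of the current clique by the vertex just created.
    The map [slot w] is the current clique, to which vertex [inr w] is
    joined. *)
Fixpoint slot k (w : seq 'I_k) (i : 'I_k) : 'I_k + seq 'I_k :=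
  if w is a :: w' then if i == a then inr w' else slot w' i else inl i.

(** On the roots, the relation is symmetric: they are pairwise adjacent. *)
Definition older k (x y : 'I_k + seq 'I_k) : bool :=
  match x, y with
  | inl i, inl j => i != j
  | inl _, inr _ => false
  | inr w, _ => [exists i, slot w i == y]
  end.

Definition word_adj k (x y : 'I_k + seq 'I_k) := older x y || older y x.

Lemma slot_size k (w u : seq 'I_k) i : slot w i = inr u -> size u < size w.
Proof.
elim: w => //= a w IHw; case: eqP => [_ [->]//|_ /IHw]; exact: leqW.
Qed.

Lemma word_adj_sym k : symmetric (@word_adj k).
Proof. by move=> x y; rewrite /word_adj orbC. Qed.

Lemma word_adj_irrefl k : irreflexive (@word_adj k).
Proof.
move=> [i|w]; rewrite /word_adj orbb /= ?eqxx //.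
by apply/existsP=> -[i /eqP/slot_size]; rewrite ltnn.
Qed.

Lemma slot_adj k (w : seq 'I_k) i j : i != j -> word_adj (slot w i) (slot w j).
Proof.
elim: w => [|a w IHw] /= ij; first by rewrite /word_adj /= ij.
case: (eqVneq i a) => [ia|ia]; case: (eqVneq j a) => [ja|ja].
- by rewrite ia ja eqxx in ij.
- by rewrite /word_adj; apply/orP; left; apply/existsP; exists j.
- by rewrite /word_adj; apply/orP; right; apply/existsP; exists i.
- exact: IHw.
Qed.

Lemma slot_inj k (w : seq 'I_k) : injective (slot w).
Proof.
move=> i j e; apply: contrapT => /eqP /(slot_adj w).
by rewrite e word_adj_irrefl.
Qed.

(** The longest word among the slots of [a :: u] is [u], and the missing slot
    of [u] determines [a]. *)
Lemma slots_inj k (a b : 'I_k) (u u' : seq 'I_k) :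
  (forall y, older (inr (a :: u)) y = older (inr (b :: u')) y) -> a :: u = b :: u'.
Proof.
move=> same.
have top (c e : 'I_k) (v v' : seq 'I_k) :
    older (inr (c :: v)) (inr v') -> v' = v \/ size v' < size v.
  case/existsP=> i /eqP /=; case: eqP => [_ [->]|_ /slot_size]; [by left|by right].
have h1 : older (inr (a :: u)) (inr u).
  by apply/existsP; exists a; rewrite /= eqxx.
have h2 : older (inr (b :: u')) (inr u').
  by apply/existsP; exists b; rewrite /= eqxx.
have uu' : u = u'.
  have := top _ a _ _ (etrans (esym (same _)) h1).
  have := top _ b _ _ (etrans (same _) h2).
  by case=> [//|lt1] [//|lt2]; have := ltn_trans lt1 lt2; rewrite ltnn.
subst u'; congr cons; apply: contrapT => /eqP ab.
have : older (inr (a :: u)) (slot u b).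
  by apply/existsP; exists b; rewrite /= [b == a]eq_sym (negPf ab).
rewrite same => /existsP[i] /=; case: (i =P b) => [_ /eqP/esym/slot_size|ib].
  by rewrite ltnn.
by move/eqP/slot_inj.
Qed.

(** Vertex [u] remains in the current clique as long as the letter that put
    it there is not used again. *)
Lemma slot_cat k (w u : seq 'I_k) i : i \notin w -> slot (w ++ i :: u) i = inr u.
Proof.
by elim: w => [|a w IHw] /=; rewrite ?eqxx // inE negb_or => /andP[/negPf-> /IHw].
Qed.

Section WordGraph.

Variables k d : nat.

Definition word_vertex : finType := ('I_k + d.-bseq 'I_k)%type.

Definition raw_vertex (x : word_vertex) : 'I_k + seq 'I_k :=
  match x with inl i => inl i | inr w => inr (bseqval w) end.

Definition to_vertex (y : 'I_k + seq 'I_k) : word_vertex :=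
  match y with inl i => inl i | inr w => inr (insub_bseq d w) end.

Lemma raw_vertexK : cancel raw_vertex to_vertex.
Proof.
case=> //= w; congr inr; apply: val_inj.
by rewrite /= /insub_bseq insubdK // unfold_in size_bseq.
Qed.

Lemma to_vertexK (w : seq 'I_k) : size w <= d -> raw_vertex (to_vertex (inr w)) = inr w.
Proof. by move=> wd /=; rewrite /insub_bseq insubdK. Qed.

Definition word_graph : graph :=
  @Graph word_vertex (fun x y => word_adj (raw_vertex x) (raw_vertex y))
    (fun x y => word_adj_sym (raw_vertex x) (raw_vertex y))
    (fun x => word_adj_irrefl (raw_vertex x)).


Definition slots (w : d.-bseq 'I_k) : {set word_graph} :=
  [set x : word_vertex | older (inr (bseqval w)) (raw_vertex x)].

Definition word_region (S : {set d.-bseq 'I_k}) : {set word_graph} :=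
  [set x : word_vertex | if x is inr w then w \in S else true].

Lemma raw_vertex_slot (w : d.-bseq 'I_k) i : raw_vertex (to_vertex (slot w i)) = slot w i.
Proof.
case E: (slot w i) => [//|u]; apply: to_vertexK.
exact: leq_trans (ltnW (slot_size E)) (size_bseq w).
Qed.

Lemma slots_imset (w : d.-bseq 'I_k) :
  slots w = [set to_vertex (slot w i) | i : 'I_k].
Proof.
apply/setP=> x; rewrite inE; apply/existsP/imsetP => [[i /eqP ix]|[i _ ->]].
  by exists i; rewrite // ix raw_vertexK.
by exists i; rewrite raw_vertex_slot.
Qed.

Lemma slots_clique (w : d.-bseq 'I_k) : clique (slots w).
Proof.
rewrite slots_imset => _ _ /imsetP[i _ ->] /imsetP[j _ ->] ij /=.
by rewrite !raw_vertex_slot; apply: slot_adj; apply: contra_neq ij => ->.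
Qed.

Lemma card_slots (w : d.-bseq 'I_k) : #|slots w| = k.
Proof.
rewrite slots_imset card_imset ?card_ord // => i j e; apply: (@slot_inj k w).
by rewrite -raw_vertex_slot e raw_vertex_slot.
Qed.

Lemma word_region_step (S : {set d.-bseq 'I_k}) (w : d.-bseq 'I_k) :
  w \in S -> word_region S = (inr w : word_graph) |: word_region (S :\ w).
Proof.
move=> wS; apply/setP=> -[i|u]; rewrite !inE //=.
by rewrite (inj_eq (@inr_inj _ _)); case: eqP => [->|].
Qed.

(** Words are created by increasing length.  The last word [w] is joined to
    its slots, which are older, and no other word has the same slots. *)
Lemma word_region_ktree (S : {set d.-bseq 'I_k}) :
  [bseq] \in S ->
  (forall a u (wd : size (a :: u) <= d), Bseq wd \in S ->
     insub_bseq d u \in S) ->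
  simple_ktree_seq k (word_region S)
    [set slots w | w in S :\ [bseq]].
Proof.
have [n] := ubnP #|S|; elim: n S => // n IHn S Sn nilS closed.
have [S1|[w0 w0S]] := set_0Vmem (S :\ [bseq]).
  rewrite S1 imset0; apply: SimpleKtreeStart.
    move=> x y; rewrite !inE.
    have in1 u : u \in S -> u = [bseq].
      move=> uS; apply/eqP; apply: contraT => u0.
      by have := in_set0 u; rewrite -S1 !inE uS u0.
    case: x y => [i|u] [j|u'] /=; rewrite /word_adj /=.
    + by move=> _ _; rewrite (inj_eq (@inl_inj _ _)) => ->.
    + move=> _ /in1-> _; apply/existsP; exists i => //=.
    + move=> /in1-> _ _; apply/orP; left; apply/existsP; exists j => //=.
    + by move=> /in1-> /in1->; rewrite eqxx.
  have -> : word_region S = (inr [bseq] : word_graph) |: slots [bseq].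
    rewrite (word_region_step nilS) S1; congr (_ |: _).
    apply/setP=> -[i|u]; rewrite !inE /=.
      by apply/esym/existsP; exists i.
    by apply/esym/existsP => -[].
  rewrite cardsU1 card_slots inE /=.
  by case: existsP => [[]|].
pose w := [arg max_(u > w0 in S :\ [bseq]) size u].
have [wS wmax] : w \in S :\ [bseq] /\ forall u, u \in S :\ [bseq] -> size u <= size w.
  by rewrite /w; case: arg_maxnP.
clearbody w; move: (wS); rewrite !inE => /andP[w0' wS'].
have wmaxS u : u \in S -> size u <= size w.
  by move=> uS; have [->//|u0] := eqVneq u [bseq]; apply: wmax; rewrite !inE u0.
have sufx u v (i : 'I_k) : u \in S -> slot (bseqval u) i = inr v ->
    insub_bseq d v \in S.
  case: u => s; elim: s => [//|a s IHs] sd uS /=.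
  case: eqP => [_ [<-]|_ sv]; first exact: closed uS.
  have sd' : size s <= d by apply: ltnW.
  apply: (IHs sd') => //; have := closed a s sd uS.
  by congr (_ \in S); apply: val_inj; rewrite /= /insub_bseq insubdK.
rewrite (word_region_step wS').
have -> : [set slots u | u in S :\ [bseq]] =
    slots w |: [set slots u | u in (S :\ w) :\ [bseq]].
  have -> : S :\ w :\ [bseq] = S :\ [bseq] :\ w by rewrite !setDDl setUC.
  by rewrite -imsetU1 setD1K.
have small (y : seq 'I_k) (u : d.-bseq 'I_k) : older (inr (bseqval u)) (inr y) -> size y < size u.
  by case/existsP=> i /eqP/slot_size.
apply: SimpleKtreeStep.
- apply: IHn.
  + by rewrite (cardsD1 w) wS' in Sn.
  + by rewrite !inE eq_sym w0'.
  + move=> a u ud; rewrite !inE => /andP[uw uS]; rewrite (closed _ _ _ uS) andbT.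
    apply/eqP=> e; have := wmaxS _ uS; rewrite -e /= /insub_bseq insubdK ?ltnn //.
    by apply: ltnW.
- apply/subsetP=> -[i|u]; rewrite !inE //= => wu.
  apply/andP; split; first by apply/eqP=> e; have := small _ _ wu; rewrite e ltnn.
  case/existsP: wu => i /eqP/(sufx _ _ _ wS'); congr (_ \in S); apply: val_inj.
  by rewrite /= /insub_bseq insubdK // unfold_in size_bseq.
- exact: slots_clique.
- exact: card_slots.
- apply/imsetP=> -[u uS e]; move: uS; rewrite !inE => /and3P[u0 uw uS].
  case/eqP: uw; apply: val_inj => /=.
  have Eu : exists b s, bseqval u = b :: s.
    by case: (u) u0 => -[|b s] ?; [rewrite -val_eqE eqxx|exists b, s].
  have Ew : exists b s, bseqval w = b :: s.
    by case: (w) w0' => -[|b s] ?; [rewrite -val_eqE eqxx|exists b, s].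
  case: Eu Ew => b [s Eu] [a [t Ew]]; rewrite Eu Ew; apply: slots_inj => y.
  rewrite -Eu -Ew; case: y => [i|y].
    by have /setP/(_ (inl i)) := e; rewrite !inE.
  have [yd|yd] := leqP (size y) d.
    have /setP/(_ (inr (insub_bseq d y))) := e; rewrite !inE.
    by have := to_vertexK yd => /= ->.
  have big (v : d.-bseq 'I_k) : older (inr (bseqval v)) (inr y) = false.
    case yv: (older _ _) => //; have := leq_trans (small _ _ yv) (size_bseq v).
    by rewrite leqNgt ltnS (ltnW yd).
  by rewrite !big.
- by rewrite !inE eqxx.
- move=> x xS; rewrite inE /= /word_adj; case E: (older (raw_vertex x) _); last first.
    by rewrite orbF.
  move: E xS; case: x => [//|u]; rewrite !inE => wu /andP[_ /wmaxS uw].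
  by have := leq_trans (small _ _ wu) uw; rewrite ltnn.
Qed.

Lemma stw_word_graph : stw word_graph <= k.
Proof.
have [_ minP] := min_natP (stw_subproof word_graph); apply: minP.
exists word_graph; last by exists id; split.
eexists; have <- : word_region [set: d.-bseq 'I_k] = [set: word_graph].
  by apply/setP=> -[i|w]; rewrite !inE.
by apply: word_region_ktree => [|a u wd _]; rewrite in_setT.
Qed.

End WordGraph.

(** * Forcing large weak reachability *)

(** The copies of lower dimension used below are obtained by restricting the
    alphabet [I]. *)
Definition word_over (T : eqType) (I : seq T) (d : nat) (u : seq T) : bool :=
  all (mem I) u && (size u <= d).

Definition word_image (T : eqType) (I : seq T) (d : nat) (G : graph)
    (phi : seq T -> G) : {set G} :=
  [set x | `[< exists2 u, word_over I d u & phi u = x >]].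

Lemma word_imageP (T : eqType) (I : seq T) d (G : graph) (phi : seq T -> G) x :
  reflect (exists2 u, word_over I d u & phi u = x) (x \in word_image I d phi).
Proof. by rewrite inE; apply: asboolP. Qed.

(** Only one implication is required for adjacency, and the map [phi] only
    matters on short words: this is what survives when the universal
    tree is embedded in itself by appending a fixed suffix. *)
Definition word_embedding (T : eqType) (I : seq T) (d : nat) (G : graph)
    (phi : seq T -> G) : Prop :=
  (forall u v, word_over I d u -> word_over I d v -> phi u = phi v -> u = v) /\
  (forall u i v, word_over I d (u ++ i :: v) -> i \notin u ->
     adj G (phi (u ++ i :: v)) (phi v)).

(** Quantifying over all embeddings makes the induction apply to the copies
    of the word graphs found inside larger ones, with the order induced
    there. *)
Definition forces (k r m : nat) : Prop :=
  exists d, forall (G : graph) (le : rel G) (T : eqType) (I : seq T)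
    (phi : seq T -> G),
  linear_order le -> uniq I -> size I = k -> word_embedding I d phi ->
  exists2 v, v \in word_image I d phi &
    m <= #|reach_set (word_image I d phi) le r [set v]|.

Lemma forces0 k r : forces k r 0.
Proof.
by exists 0 => G le T I phi _ _ _ _; exists (phi [::]) => //; apply/word_imageP; exists [::].
Qed.

(** If v = phi u0, copy number t consists of the words ending in
    j^(t(d2+1)) i u0 with no further occurrence of i: they are adjacent to u0,
    and the lengths of the words distinguish the copies. *)
Lemma forces_step k r m1 m2 :
  0 < k -> forces k.+1 r m1 -> forces k r.+1 m2 -> forces k.+1 r.+1 (m1 + m2).
Proof.
move=> k_gt0 [d1 f1] [d2 f2]; pose N := m1 + m2.
exists (d2 + (N * d2.+1 + d1.+1)) => G le T I phi lin uI sI [phi_inj phi_adj].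
set d := d2 + _ in phi_inj phi_adj *; set W := word_image I d phi.
have [refl anti trans tot] := lin.
have widen u : word_over I d1 u -> word_over I d u.
  by case/andP=> uI' u1; rewrite /word_over uI'; rewrite /d; lia.
have [|v vW1 vm1] := f1 G le T I phi lin uI sI.
  by split=> [u v /widen uW /widen|u i v /widen]; [apply: phi_inj|apply: phi_adj].
have [u0 u0W u0v] := word_imageP _ _ _ _ vW1.
have [u0I u0d] := andP u0W.
case: I sI uI @W phi_inj phi_adj widen f1 vW1 vm1 u0W u0I => // i [|j J'] [sJ].
  by rewrite -sJ in k_gt0.
set I := i :: j :: J' => /andP[]; set J := j :: J' => iJ uJ W phi_inj phi_adj
  widen f1 vW1 vm1 u0W u0I.
have JI x : x \in J -> x \in I by move=> xJ; rewrite inE xJ orbT.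
pose stem t := nseq (t * d2.+1) j ++ i :: u0.
have stemE t x : x ++ stem t = (x ++ nseq (t * d2.+1) j) ++ i :: u0.
  by rewrite catA.
have over t x : t < N -> word_over J d2 x -> word_over I d (x ++ stem t).
  move=> tN /andP[xJ xd]; rewrite /word_over /stem !all_cat /= u0I andbT.
  rewrite (sub_all JI xJ) all_nseq !inE !eqxx !orbT /= !size_cat size_nseq /=.
  have := leq_mul tN (leqnn d2.+1); rewrite /d; lia.
pose phit t x := phi (x ++ stem t).
have emb t : t < N -> word_embedding J d2 (phit t).
  move=> tN; split=> [x y xW yW /phi_inj e|x a y xW ax].
    have {}e := e (over _ _ tN xW) (over _ _ tN yW).
    have sxy : size x = size y by move/(congr1 size): e; rewrite !size_cat => /addIn.
    by move/eqP: e; rewrite eqseq_cat // => /andP[/eqP].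
  by rewrite /phit -catA; apply: phi_adj => //; rewrite -cat_cons catA; apply: over.
have sub t : t < N -> word_image J d2 (phit t) \subset W.
  move=> tN; apply/subsetP=> _ /word_imageP[x xW <-]; apply/word_imageP.
  by exists (x ++ stem t) => //; apply: over.
have vW : v \in W by apply/word_imageP; exists u0 => //; apply: widen.
have vadj t x : t < N -> x \in word_image J d2 (phit t) -> adj G x v.
  move=> tN /word_imageP[w wW <-]; rewrite -u0v /phit stemE; apply: phi_adj.
    by rewrite -stemE; apply: over.
  rewrite mem_cat mem_nseq negb_or; apply/andP; split.
    by apply: contra iJ => iw; have /andP[/allP/(_ _ iw)] := wW.
  by rewrite negb_and; apply/orP; right; apply: contraNneq iJ => ->; rewrite mem_head.
have disj t t' x : t < N -> t' < N -> x \in word_image J d2 (phit t) ->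
    x \in word_image J d2 (phit t') -> t = t'.
  move=> tN tN' /word_imageP[w wW <-] /word_imageP[w' wW' /phi_inj e].
  have {}e := congr1 size (e (over _ _ tN' wW') (over _ _ tN wW)).
  move: e wW wW' => + /andP[_ +] /andP[_ +].
  rewrite !size_cat !size_nseq /= => e wd wd'.
  have {}e : size w' + t' * d2.+1 = size w + t * d2.+1 by move: e; clear; lia.
  have := congr1 (fun z => z %/ d2.+1) e.
  by rewrite ![size _ + _]addnC !divnMDl // !divn_small ?ltnS ?addn0.
have [small|] := pselect (forall t : 'I_N, exists2 x,
    x \in word_image J d2 (phit t) & le x v).
  exists v => //; have [x xP] := choice (fun t => let: ex_intro2 x h1 h2 := small t in ex_intro _ x (conj h1 h2)).
  have xinj : injective x.
    move=> t t' e; apply: val_inj; apply: (disj t t' (x t)) => //.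
      by case: (xP t).
    by rewrite e; case: (xP t').
  apply: (@leq_trans #|x @: [set: 'I_N]|).
    by rewrite card_imset // cardsT card_ord.
  apply: subset_leq_card; apply/subsetP=> _ /imsetP[t _ ->]; apply/reach_set1P.
  have [xt xv] := xP t; exists [:: x t]; split=> //=.
  - by rewrite adj_sym (vadj t).
  - move=> z; rewrite in_cons mem_seq1 => /orP[]/eqP-> //.
    by apply: (subsetP (sub t (ltn_ord t))).
  - by move=> z; rewrite in_cons mem_seq1 => /orP[]/eqP->.
(* copy t lies entirely above v *)
move/existsNP=> [t tP]; have tN := ltn_ord t.
have big x : x \in word_image J d2 (phit t) -> ~ le x v.
  by move=> xt xv; apply: tP; exists x.
have [w wt wm2] := f2 G le T J (phit t) lin uJ sJ (emb t tN).
exists w; first exact: subsetP (sub t tN) _ wt.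
set R1 := reach_set _ _ _ _ in vm1; set R2 := reach_set _ _ _ _ in wm2.
have R1v y : y \in R1 -> le y v.
  by move=> /reach_set1P[p [_ _ _ _ pmin]]; apply: pmin; rewrite mem_head.
have R12 : R1 :&: R2 = set0.
  apply/setP=> y; rewrite in_set0; apply/negP=> /setIP[/R1v yv yR2].
  exact: big (subsetP (reach_set_sub _ _ _ _) _ yR2) yv.
apply: leq_trans (leq_add vm1 wm2) _; rewrite -cardsUI R12 cards0 addn0.
apply: subset_leq_card; rewrite subUset; apply/andP; split; last first.
  exact: reach_set_mono (sub t tN) (leqnn _).
apply/subsetP=> y yR1; have yv := R1v y yR1; have wv := vadj t w tN wt.
have vw : le v w by case/orP: (tot v w) => // /(big w wt).
move: yR1 => /reach_set1P[p [vP pW lp sp pmin]]; apply/reach_set1P.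
exists (v :: p); split=> //=.
- by rewrite wv.
- move=> z; rewrite in_cons => /orP[/eqP->|/pW/word_imageP[u uW <-]].
    exact: subsetP (sub t tN) _ wt.
  by apply/word_imageP; exists u => //; apply: widen.
- by move=> z; rewrite in_cons => /orP[/eqP->|/pmin//]; apply: trans vw.
Qed.

(** * Lower bound for paths *)

Definition segment (G : graph) (f : nat -> G) (a l : nat) : {set G} :=
  [set f (a + i) | i : 'I_l].

Lemma segmentP (G : graph) (f : nat -> G) a l x :
  reflect (exists2 n, a <= n < a + l & x = f n) (x \in segment f a l).
Proof.
apply: (iffP imsetP) => [[i _ ->]|[n /andP[an nl] ->]].
  by exists (a + i); rewrite // leq_addr ltn_add2l ltn_ord.
have il : n - a < l by rewrite ltn_subLR.
by exists (Ordinal il); rewrite //= subnKC.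
Qed.

Lemma segment_walk (G : graph) (f : nat -> G) a l n n' :
  (forall i, a <= i -> i.+1 < a + l -> adj G (f i) (f i.+1)) ->
  a <= n < a + l -> a <= n' < a + l ->
  exists p, [/\ path (adj G) (f n) p, last (f n) p = f n', size p < l
    & {subset f n :: p <= segment f a l}].
Proof.
move=> fadj nP n'P.
suff [p [pP lp sp pS]] : exists p, [/\ path (adj G) (f n) p,
    last (f n) p = f n', size p = (n - n') + (n' - n)
    & {subset f n :: p <= segment f a l}].
  by exists p; split=> //; rewrite sp; clear -nP n'P; lia.
have [m] := ubnP ((n - n') + (n' - n)); elim: m => // m IHm in n nP *.
have nS : f n \in segment f a l by apply/segmentP; exists n.
case: (ltngtP n n') => [nn|nn|->] hm; last first.
- exists [::]; split=> //; first by rewrite /= subnn.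
  by move=> z; rewrite mem_seq1 => /eqP->; apply/segmentP; exists n'.
- have [||p [pP lp sp pS]] := IHm n.-1; [lia|lia|].
  have e : n = n.-1.+1 by lia.
  exists (f n.-1 :: p); split=> //=.
  + by rewrite pP andbT adj_sym {2}e fadj //; lia.
  + by rewrite sp; lia.
  + by move=> z; rewrite in_cons => /orP[/eqP->|/pS].
- have [||p [pP lp sp pS]] := IHm n.+1; [lia|lia|].
  exists (f n.+1 :: p); split=> //=.
  + by rewrite pP andbT fadj //; lia.
  + by rewrite sp; lia.
  + by move=> z; rewrite in_cons => /orP[/eqP->|/pS].
Qed.

Lemma segment_min (G : graph) (le : rel G) (f : nat -> G) a l :
  linear_order le -> 0 < l ->
  exists2 n, a <= n < a + l & forall i, a <= i < a + l -> le (f n) (f i).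
Proof.
move=> [refl anti trans tot]; elim: l => // -[|l] IHl _.
  exists a => [|i]; first lia.
  by move=> ai; have -> : i = a by lia.
have [//|n nP nmin] := IHl.
have [le_n|le_l] := orP (tot (f n) (f (a + l.+1))).
  exists n => [|i iP]; first lia.
  have [->//|il] := eqVneq i (a + l.+1).
  by apply: nmin; lia.
exists (a + l.+1) => [|i iP]; first lia.
have [->|il] := eqVneq i (a + l.+1); first exact: refl.
by apply: trans le_l (nmin i _); lia.
Qed.

(** The minimum of a segment is reachable from everywhere in it; in the half
    that avoids it, induction provides a vertex that reaches [m] others. *)
Lemma segment_reach (G : graph) (le : rel G) (f : nat -> G) m a :
  linear_order le ->
  (forall i j, a <= i < a + 2 ^ m -> a <= j < a + 2 ^ m -> f i = f j -> i = j) ->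
  (forall i, a <= i -> i.+1 < a + 2 ^ m -> adj G (f i) (f i.+1)) ->
  exists2 v, v \in segment f a (2 ^ m) &
    m < #|reach_set (segment f a (2 ^ m)) le (2 ^ m).-1 [set v]|.
Proof.
move=> lin; have [refl anti trans tot] := lin.
elim: m a => [|m IHm] a inj fadj.
  have aS : f a \in segment f a (2 ^ 0).
    by apply/segmentP; exists a => //; rewrite expn0; lia.
  exists (f a) => //; apply/card_gt0P; exists (f a); apply/reach_set1P.
  by exists [::]; split=> // z; rewrite mem_seq1 => /eqP-> //; exact: refl.
have E2 : 2 ^ m.+1 = 2 ^ m + 2 ^ m by rewrite expnS mul2n addnn.
have m_gt0 : 0 < 2 ^ m by rewrite expn_gt0.
have [|n0 n0P n0min] := @segment_min _ _ f a (2 ^ m.+1) lin; first by rewrite expn_gt0.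
(* the half avoiding the minimum, so that f n0 is new among the reached *)
pose b := if n0 < a + 2 ^ m then a + 2 ^ m else a.
have bP i : b <= i < b + 2 ^ m -> (a <= i < a + 2 ^ m.+1) /\ i != n0.
  by rewrite /b E2; case: ifP; split; lia.
have [||v vS vm] := IHm b.
- by move=> i j /bP[iP _] /bP[jP _]; apply: inj.
- move=> i bi il; have [|iP _] := bP i; first lia.
  have [|iP' _] := bP i.+1; first lia.
  by apply: fadj; lia.
have sub : segment f b (2 ^ m) \subset segment f a (2 ^ m.+1).
  by apply/subsetP=> _ /segmentP[i /bP[iP _] ->]; apply/segmentP; exists i.
exists v; first exact: subsetP sub _ vS.
set R := reach_set _ _ _ _ in vm.
have n0R : f n0 \notin R.
  apply/negP => /(subsetP (reach_set_sub _ _ _ _))/segmentP[i /bP[iP]].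
  by move=> /eqP ne /inj e; apply: ne; rewrite e.
apply: (@leq_trans #|f n0 |: R|); first by rewrite cardsU1 n0R.
apply: subset_leq_card; rewrite subUset sub1set; apply/andP; split; last first.
  by apply: reach_set_mono => //; rewrite E2; lia.
have [n nP ->] := segmentP _ _ _ _ vS; have [nP' _] := bP n nP.
have [p [pP lp sp pS]] := segment_walk fadj nP' n0P.
apply/reach_set1P; exists p; split=> //; first by rewrite -ltnS prednK ?expn_gt0.
by move=> z /pS/segmentP[i iP ->]; apply: n0min.
Qed.

Lemma forces_path r : forces 1 r (trunc_log 2 r.+1).+1.
Proof.
set m := trunc_log 2 r.+1.
have rm : 2 ^ m <= r.+1 by apply: trunc_logP.
exists (2 ^ m) => G le T [//|i [|//]] phi lin _ _ [phi_inj phi_adj].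
pose f n := phi (nseq n i).
have over n : n <= 2 ^ m -> word_over [:: i] (2 ^ m) (nseq n i).
  move=> nm; rewrite /word_over size_nseq nm andbT; apply/allP=> x.
  by rewrite mem_nseq => /andP[_ /eqP->]; apply: mem_head.
have [||v vS vm] := @segment_reach G le f m 0 lin.
- move=> n n' /andP[_ nP] /andP[_ nP'] /phi_inj e.
  by have := congr1 size (e (over _ (ltnW nP)) (over _ (ltnW nP'))); rewrite !size_nseq.
- move=> n _ nP; rewrite adj_sym; apply: (phi_adj [::]) => //=.
  by apply: (over n.+1); apply: ltnW.
have sub : segment f 0 (2 ^ m) \subset word_image [:: i] (2 ^ m) phi.
  apply/subsetP=> _ /segmentP[n /andP[_ nP] ->]; apply/word_imageP.
  by exists (nseq n i) => //; apply: over; apply: ltnW.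
exists v; first exact: subsetP sub _ vS.
apply: leq_trans vm (subset_leq_card _); apply: reach_set_mono => //.
by rewrite -ltnS prednK ?expn_gt0.
Qed.

Lemma forces_wcol k r m : forces k r m ->
  exists2 G : graph, stw G <= k & m <= wcol r G.
Proof.
case=> d fd; exists (word_graph k d); first exact: stw_word_graph.
have [le lin leP] := wcolP r (word_graph k d).
pose phi (w : seq 'I_k) : word_graph k d := to_vertex d (inr w).
have [|||v _ vm] := fd (word_graph k d) le 'I_k (enum 'I_k) phi lin.
- exact: enum_uniq.
- by rewrite size_enum_ord.
- split=> [u w /andP[_ ud] /andP[_ wd] /(congr1 (@raw_vertex k d))|u i w /andP[_ ud] iu].
    by rewrite !to_vertexK // => -[].
  change (is_true (word_adj (raw_vertex (phi (u ++ i :: w))) (raw_vertex (phi w)))).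
  rewrite /word_adj !to_vertexK //; last first.
    by move: ud; rewrite size_cat /=; lia.
  by apply/orP; left; apply/existsP; exists i; rewrite slot_cat.
apply: leq_trans vm _; apply: leq_trans (leP v); rewrite WReachE.
by apply: subset_leq_card; apply: reach_set_mono; rewrite ?subsetT.
Qed.

(** * Real estimates and conclusion *)

Section RealEstimates.
Variable R : realType.
Local Open Scope ring_scope.

Lemma trunc_log2_le (r : nat) : (0 < r)%N -> (trunc_log 2 r)%:R <= log2 (r%:R : R).
Proof.
move=> r_gt0; rewrite /log2 ler_pdivlMr ?ln_gt0 ?ltr1n // mulr_natl -lnXn ?ltr0n //.
rewrite ler_ln ?posrE ?exprn_gt0 ?ltr0n // -natrX ler_nat.
exact: trunc_logP.
Qed.

Lemma ln2_le1 : ln (2 : R) <= 1.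
Proof. by have := @le_ln1Dx R 1; rewrite -[1 + 1]/(2 : R); apply; lra. Qed.

Lemma ln_le_trunc_log (r : nat) : (0 < r)%N ->
  ln (r%:R : R) <= ((trunc_log 2 r.+1).+1)%:R.
Proof.
move=> r_gt0; set m := (trunc_log 2 r.+1).+1.
have rm : (r <= 2 ^ m)%N by apply/ltnW/(leq_trans _ (ltnW (trunc_log_ltn _ _))).
apply: (@le_trans _ _ (ln ((2 : R) ^+ m))).
  by rewrite ler_ln ?posrE ?exprn_gt0 ?ltr0n // -natrX ler_nat.
by rewrite lnXn ?ltr0n // -[ln 2 *+ m]mulr_natl ler_piMr ?ler0n ?ln2_le1.
Qed.

(** From 1 + x <= exp x at x = -1/6: 6 ln (6/5) >= 1, and (6/5)^6 <= 3. *)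
Lemma ln3_ge1 : 1 <= ln (3 : R).
Proof.
have h : ln ((6 / 5 : R) ^+ 6) <= ln (3 : R).
  by rewrite ler_ln ?posrE; [lra|apply: exprn_gt0; lra|lra].
apply: le_trans h; rewrite lnXn; last lra.
have ln56 : ln (1 + - (1 / 6) : R) <= - (1 / 6) by apply: le_ln1Dx; lra.
have e56 : 1 + - (1 / 6) = (6 / 5)^-1 :> R by lra.
move: ln56; rewrite e56 lnV ?posrE; last lra.
by rewrite -mulr_natr; lra.
Qed.

Lemma expnS_le (y n : nat) : (y.+1 ^ n.+1 <= y ^ n.+1 + n.+1 * y.+1 ^ n)%N.
Proof.
elim: n => [|n IHn]; first by rewrite !expn1 expn0 muln1 addn1.
have : (y ^ n.+1 <= y.+1 ^ n.+1)%N by rewrite leq_exp2r.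
have := leq_mul (leqnn y.+1) IHn; rewrite mulnDr mulnCA -!expnS (expnS y n.+1).
by move: (y.+1 ^ _)%N (y ^ _)%N (y.+1 ^ _)%N => a b c; lia.
Qed.

(** The derivative of x^(n+1) ln x is at most (n+2) x^n ln x as soon as
    ln x >= 1.  This covers r >= 2, by the discrete estimates
    (r+1)^(n+1) - r^(n+1) <= (n+1) (r+1)^n and ln (r+1) - ln r <= 1/r;
    the case r = 1 is direct since ln 1 = 0. *)
Lemma ln_recursion (r n : nat) : (0 < r)%N ->
  r.+1%:R ^+ n.+1 * ln (r.+1%:R : R) <=
    r%:R ^+ n.+1 * ln r%:R + n.+2%:R * (r.+1%:R ^+ n * ln r.+1%:R).
Proof.
move=> r_gt0; set x : R := r.+1%:R; set y : R := r%:R.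
have xE : x = y + 1 by rewrite /x /y -natr1.
have y_ge1 : 1 <= y by rewrite ler1n.
have n_ge0 : 0 <= n%:R :> R by rewrite ler0n.
have nE : n.+1%:R = n%:R + 1 :> R by rewrite -natr1.
have nE' : n.+2%:R = n%:R + 2 :> R by rewrite -addn2 natrD.
have pow : x * x ^+ n <= y * y ^+ n + n.+1%:R * x ^+ n.
  by rewrite -!exprS -!natrX -natrM -natrD ler_nat expnS_le.
have Y0 : 0 <= y ^+ n by rewrite exprn_ge0 // ler0n.
have YX : y ^+ n <= x ^+ n by rewrite lerXn2r ?nnegrE ?ler0n // xE; lra.
have lx : 0 <= ln x by rewrite ln_ge0 // xE; lra.
rewrite !exprS; move: pow Y0 YX.
case: (ltngtP r 1) => [|r_gt1|r1].
- by rewrite ltnNge r_gt0.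
- have lx1 : 1 <= ln x.
    by apply: le_trans ln3_ge1 _; rewrite ler_ln ?posrE ?ltr0n // ler_nat.
  have ly : y * (ln x - ln y) <= 1.
    have y0 : 0 < y by lra.
    have -> : ln x - ln y = ln (1 + y^-1).
      rewrite -ln_div ?posrE ?ltr0n //; congr ln.
      by rewrite xE mulrDl mul1r divff // gt_eqF.
    have yV : -1 < y^-1 by apply: lt_trans (_ : 0 < y^-1); rewrite ?invr_gt0 //; lra.
    by have := ler_wpM2l (ltW y0) (le_ln1Dx yV); rewrite divff // gt_eqF.
  rewrite nE nE'; move: (x ^+ n) (y ^+ n) (ln x) (ln y) lx lx1 ly => X Y l l'.
  move=> l0 l1 ly pow Y0 YX; nra.
have ly : ln y = 0 by rewrite /y r1 ln1.
rewrite nE' ly /y r1; move: (x ^+ n) (y ^+ n) (ln x) lx => X Y l l0 pow Y0 YX.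
have -> : x = 2 by rewrite xE /y r1; lra.
have : 0 <= n%:R * (X * l) by rewrite !mulr_ge0 //; lra.
nra.
Qed.

Lemma forces_log (n r : nat) : (0 < r)%N ->
  exists2 m, forces n.+1 r m &
    r%:R ^+ n * ln (r%:R : R) / (n.+1)`!%:R <= m%:R.
Proof.
elim: n r => [|n IHn] r r_gt0.
  exists (trunc_log 2 r.+1).+1; first exact: forces_path.
  by rewrite expr0 mul1r factS fact0 divr1 ln_le_trunc_log.
elim: r r_gt0 => // r IHr _.
case: (posnP r) => [->|r_gt0].
  by exists 0; [apply: forces0|rewrite ln1 mulr0 mul0r].
have [m1 f1 m1P] := IHr r_gt0; have [m2 f2 m2P] := IHn r.+1 isT.
exists (m1 + m2)%N; first exact: forces_step.
rewrite natrD; apply: le_trans (lerD m1P m2P).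
have f_gt0 : 0 < (n.+1)`!%:R :> R by rewrite ltr0n fact_gt0.
have n2_gt0 : 0 < n.+2%:R :> R by rewrite ltr0n.
have := ln_recursion n r_gt0; rewrite factS natrM.
move: (r.+1%:R ^+ n.+1 * _) (r%:R ^+ n.+1 * _) (r.+1%:R ^+ n * _) => a b c abc.
rewrite ler_pdivrMr ?mulr_gt0 // mulrDl.
rewrite divfK ?gt_eqF ?mulr_gt0 // [n.+2%:R * _]mulrC mulrA divfK ?gt_eqF //.
by rewrite [c * _]mulrC.
Qed.
End RealEstimates.

Theorem theorem2 (R : realType) :
  (exists C : R, (0 < C)%R /\
     forall (k r : nat) (G : graph),
       (1 <= k)%N -> (2 <= r)%N -> (stw G <= k)%N ->
       ((wcol r G)%:R <= C * r%:R ^+ (k - 1) * log2 r%:R)%R)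
  /\
  (forall k r : nat, (1 <= k)%N -> (1 <= r)%N ->
     exists G : graph, (stw G <= k)%N /\
       (r%:R ^+ (k - 1) * ln (r%:R : R) / (k`!)%:R <= (wcol r G)%:R)%R).
Proof.
split.
  exists 48%:R%R; split=> [|[//|n] r G _ r_ge2 Gk]; first by rewrite ltr0n.
  rewrite subn1 /=; have r_gt0 : 0 < r by apply: ltnW.
  have t_ge1 : 1 <= trunc_log 2 r by rewrite trunc_log_gt0.
  apply: (@le_trans _ _ (48 * trunc_log 2 r * r ^ n)%:R%R).
    rewrite ler_nat; apply: leq_trans (wcol_stw Gk r_ge2) _.
    by rewrite leq_mul2r; apply/orP; right; lia.
  rewrite !natrM natrX -!mulrA ler_pM2l ?ltr0n // mulrC.
  by rewrite ler_wpM2l ?exprn_ge0 ?ler0n // trunc_log2_le.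
case=> [//|n] r _ r_gt0; have [m fm mP] := forces_log R n r_gt0.
have [G Gn mG] := forces_wcol fm; exists G; split=> //.
by rewrite subn1 /=; apply: le_trans mP _; rewrite ler_nat.
Qed.
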